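(* For $a>0$ and $c\in\mathbb{R}$, let $g_2(x)=\dfrac{(\Gamma(x+a))^{1/x}}{x^c}$ for $x\in(0,\infty)$. (1) (i) For $\frac12\le a\le 1$ or $a\ge 2$: $g_2$ is strictly decreasing on $(0,\infty)$ if and only if $c\ge 1$. (ii) For $a=1$ or $a=2$: $g_2$ is strictly increasing on $(0,\infty)$ if and only if $c\le 0$. (iii) For $1<a<2$: there is a point $x_3\in(0,\infty)$, depending only on $a$ and satisfying $x_3^2\psi'(x_3+a)+\log\Gamma(x_3+a)=x_3\psi(x_3+a)$, such that $g_2$ is strictly increasing on $(0,\infty)$ if and only if $c\le h_2(x_3)$, where $h_2(x_3)=x_3\psi'(x_3+a)$. (2) For $a\ge 2$: $g_2$ is strictly logarithmically convex on $(0,\infty)$ if and only if $c\ge 1$. For $a=2$: $g_2$ is strictly logarithmically concave on $(0,\infty)$ if and only if $c\le 0$. (3) $g_2$ is geometrically convex on $(0,\infty)$ if and only if either $\frac12\le a\le 1$ and $c\in\mathbb{R}$, or $a\ge 2$ and $c\in\mathbb{R}$. Moreover, there is a point $x_3\in(0,\infty)$ satisfying $x_3^2\psi'(x_3+a)+\log\Gamma(x_3+a)=x_3\psi(x_3+a)$ (the same point $x_3$ as in (1)(iii) when $1<a<2$) such that $g_2$ is geometrically concave on $(0,x_3)$ and geometrically convex on $(x_3,\infty)$ if and only if $1<a<2$ (with either $c\ge 0$ or $c\le 0$, i.e. $c\in\mathbb{R}$ arbitrary).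
   Context: $\Gamma$ is the gamma function on $(0,\infty)$, $\psi=\Gamma'/\Gamma$ is the digamma function and $\psi'$ its derivative. A continuous $f:I\to(0,\infty)$ on an interval $I$ is logarithmically convex (concave) if $f\left(\frac{x+y}{2}\right)\le(\ge)\sqrt{f(x)f(y)}$ for all $x,y\in I$, and strictly so if the inequality is strict whenever $x\ne y$. A continuous $f:I\to(0,\infty)$ on an interval $I\subset(0,\infty)$ is geometrically convex (concave) if $f(\sqrt{x_1x_2})\le(\ge)\sqrt{f(x_1)f(x_2)}$ for all $x_1,x_2\in I$. *)

(* Defs.v *)
From HB Require Import structures.
From mathcomp Require Import all_boot all_order all_algebra.
From mathcomp Require Import all_classical all_reals all_analysis.
Set Implicit Arguments.
Unset Strict Implicit.
Unset Printing Implicit Defensive.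
Import Order.TTheory GRing.Theory Num.Theory.
Import numFieldNormedType.Exports.
Local Open Scope classical_set_scope.
Local Open Scope ring_scope.

(* Euler's integral. [Rintegral] is total: it is Gamma only for 0 < x, where
   the integral converges; this file only uses it there. *)
Definition Gamma {R : realType} (x : R) : R :=
  \int[lebesgue_measure]_(t in `]0, +oo[) (t `^ (x - 1) * expR (- t)).

Definition digamma {R : realType} (x : R) : R := (Gamma^`())%classic x / Gamma x.

Definition trigamma {R : realType} (x : R) : R := (digamma^`())%classic x.

Definition g2 {R : realType} (a c x : R) : R :=
  Gamma (x + a) `^ (x^-1) / x `^ c.

Definition x3_equation {R : realType} (a x : R) : Prop :=
  x ^+ 2 * trigamma (x + a) + ln (Gamma (x + a)) = x * digamma (x + a).

Definition strictly_increasing {R : realType} (I : interval R) (f : R -> R) :=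
  {in I &, {homo f : x y / x < y}}.

Definition strictly_decreasing {R : realType} (I : interval R) (f : R -> R) :=
  {in I &, {homo f : x y /~ x < y}}.

(* The restriction of f to I is a continuous function I -> (0, +oo). *)
Definition continuous_positive {R : realType} (I : interval R) (f : R -> R) :=
  {within [set` I], continuous f} /\ {in I, forall x, 0 < f x}.

Definition strictly_log_convex {R : realType} (I : interval R) (f : R -> R) :=
  continuous_positive I f /\
  {in I &, forall x y, x != y -> f ((x + y) / 2) < Num.sqrt (f x * f y)}.

Definition strictly_log_concave {R : realType} (I : interval R) (f : R -> R) :=
  continuous_positive I f /\
  {in I &, forall x y, x != y -> Num.sqrt (f x * f y) < f ((x + y) / 2)}.

Definition geometrically_convex {R : realType} (I : interval R) (f : R -> R) :=
  [/\ {in I, forall x, 0 < x},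
      continuous_positive I f
    & {in I &, forall x y, f (Num.sqrt (x * y)) <= Num.sqrt (f x * f y)}].

Definition geometrically_concave {R : realType} (I : interval R) (f : R -> R) :=
  [/\ {in I, forall x, 0 < x},
      continuous_positive I f
    & {in I &, forall x y, Num.sqrt (f x * f y) <= f (Num.sqrt (x * y))}].

(* Main.v *)
Require Import Defs.
From HB Require Import structures.
From mathcomp Require Import all_boot all_order all_algebra.
From mathcomp Require Import all_classical all_reals all_analysis.
From mathcomp Require Import measurable_realfun ring lra.
Set Implicit Arguments.
Unset Strict Implicit.
Unset Printing Implicit Defensive.
Import Order.TTheory GRing.Theory Num.Theory.
Import numFieldNormedType.Exports.
Local Open Scope classical_set_scope.
Local Open Scope ring_scope.

(** Write L = ln Gamma, with derivatives psi, T, U (digamma, trigamma,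
    tetragamma), and put
      w(x) = x T(x + a),   G(x) = x psi(x + a) - L(x + a),
      p(x) = x w(x) - G(x),   u(x) = x w(x) - 2 G(x) + c x.
    For F = ln g2 = L(x + a) / x - c ln x one computes
      x^2 F' = G - c x,   (G / x)' = p / x^2,   x^3 F'' = u.
    So the monotonicity of g2 compares G / x with c, and its logarithmic
    convexity is the sign of u.  Geometric convexity is convexity of F as a
    function of ln x; the derivative of F with respect to ln x is G / x - c, so
    it is the sign of p, whatever c is.

    Everything is now read off at the two ends of (0, +oo), because G' = w,
    p' = x w' and u' = x^2 U(x + a) + c, while G(0) = - L(a), p(0) = L(a) and
    u(0) = 2 L(a).  The inputs are:
    - L is strictly convex with L(1) = L(2) = 0, hence L(a) < 0 exactly
      when 1 < a < 2;
    - w is increasing and below 1 for a >= 1/2, so that p increases;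
    - G / x tends to 1 at infinity, and to 0 at 0 when L(a) = 0;
    - x^2 U(x + a) > -1 for a >= 2, so that u increases when c >= 1;
    - p grows like (a - 1/2) ln x: it becomes negative for a < 1/2, and
      positive for 1 < a < 2, where x3 is the unique zero of p.

    Nothing about Gamma is differentiated under the integral sign.  Euler's
    integral gives Gamma(x + 1) = x Gamma(x) and logarithmic convexity
    ([GammaS], [lnGamma_convex]).  By the Bohr-Mollerup argument these make L
    the limit of Gauss's approximations ([gauss_approx_error]), whose derivatives
    are finite sums of inverse powers, bounded locally uniformly from the second
    on; [derivative_of_limit] then lets three derivatives pass to the limit.
    The bounds on T and U are telescoped: a function with f(y + 1) < f(y) and
    f(y + n) -> 0 is positive ([telescoping_gt0]), so each bound reduces to an
    inequality between rational functions. *)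

(** * Euler's integral: functional equation and logarithmic convexity *)

Section GammaIntegral.
Context {R : realType}.
Implicit Types x t a b : R.
Local Notation mu := (@lebesgue_measure R).

Lemma cvg_harmonic_bound (f : R^nat) (l C : R) :
  (forall n, `|f n - l| <= C * n.+1%:R^-1) -> f @ \oo --> l.
Proof.
move=> h; apply/subr_cvg0.
have hC : (C * n.+1%:R^-1) @[n --> \oo] --> (0 : R).
  by rewrite -(mulr0 C); apply: cvgMr; exact: cvg_harmonic.
have hN : (- (C * n.+1%:R^-1)) @[n --> \oo] --> (0 : R).
  by rewrite -oppr0; exact: cvgN.
apply: (squeeze_cvgr _ hN hC).
by apply: nearW => n; rewrite -ler_norml; exact: h.
Qed.

Definition gamma_kernel x t : R := t `^ (x - 1) * expR (- t).

(** Euler's integral with values in [0, +oo]: the functional equation can be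
    established here before convergence is known, and convergence deduced from
    it. *)
Definition eGamma x : \bar R :=
  (\int[mu]_(t in `]0%R, +oo[) (gamma_kernel x t)%:E)%E.

Lemma gamma_kernel_ge0 x t : 0 <= gamma_kernel x t.
Proof. by rewrite mulr_ge0 ?powR_ge0 ?expR_ge0. Qed.

Lemma measurable_gamma_kernel x (D : set R) : measurable_fun D (gamma_kernel x).
Proof.
apply: measurable_funTS; apply: measurable_funM; first exact: measurable_powR.
by apply: measurableT_comp => //; exact: measurable_expR.
Qed.

Lemma measurable_EFin_gamma_kernel x (D : set R) :
  measurable_fun D (fun t => (gamma_kernel x t)%:E).
Proof. by apply/measurable_EFinP; exact: measurable_gamma_kernel. Qed.

Lemma is_derive_expRN t : is_derive t 1 (fun u : R => expR (- u)) (- expR (- t)).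
Proof.
have := @is_derive1_comp _ expR -%R t (expR (- t)) (- 1) _ _.
by rewrite mulrN1; apply.
Qed.

Lemma gamma_boundary_pinfty x :
  (n.+1%:R `^ x * expR (- n.+1%:R)) @[n --> \oo] --> (0 : R).
Proof.
have [k kx] : exists k : nat, x <= k%:R.
  by exists (Num.trunc `|x|).+1; apply: (le_trans (ler_norm x)); apply/ltW/truncnS_gt.
(* The term t^(k+2) / (k+2)! of the exponential series beats t^x by a factor
   of order t. *)
apply: (@cvg_harmonic_bound _ _ (k.+2)`!%:R) => n; rewrite subr0.
rewrite ger0_norm ?mulr_ge0 ?powR_ge0 ?expR_ge0//.
have n0 : 0 < n.+1%:R :> R by [].
have h : n.+1%:R ^+ k.+2 / (k.+2)`!%:R <= expR n.+1%:R :> R.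
  by apply: le_trans (expR_ge1Dxn k.+1 (ltW n0)); rewrite lerDr.
have f0 : 0 < (k.+2)`!%:R :> R by rewrite ltr0n fact_gt0.
rewrite expRN ler_pdivrMr ?expR_gt0// mulrAC ler_pdivlMr//.
rewrite -ler_pdivrMl//.
rewrite [leLHS](_ : _ = n.+1%:R `^ x * n.+1%:R / (k.+2)`!%:R); last by ring.
apply: le_trans h.
rewrite exprSr ler_pM2r ?invr_gt0// ler_pM2r//.
apply: (@le_trans _ _ (n.+1%:R `^ k.+1%:R)); last by rewrite powR_mulrn.
by apply: ler_powR; rewrite ?ler1n// (le_trans kx)// ler_nat.
Qed.

Lemma gamma_boundary_0 x : 0 < x ->
  (n.+1%:R^-1 `^ x * expR (- n.+1%:R^-1)) @[n --> \oo] --> (0 : R).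
Proof.
move=> x0; rewrite -(mul0r (expR (- 0))); apply: cvgM.
  have /cvg_at_rightP := powR_cvg0 x0; apply; split => //.
  exact: cvg_harmonic.
apply: (@cvg_comp _ _ _ (fun n : nat => - n.+1%:R^-1) expR _ (nbhs (- 0 : R))).
  by apply: cvgN; exact: cvg_harmonic.
exact: continuous_expR.
Qed.

Lemma continuous_powR (y t : R) : 0 < t -> {for t, continuous (@powR R ^~ y)}.
Proof.
move=> t0; apply/differentiable_continuous/derivable1_diffP.
by apply: derivable_powR; rewrite in_itv/= andbT.
Qed.

Lemma gamma_kernel_by_parts x a b : 0 < a -> a < b ->
  (\int[mu]_(t in `[a, b]) (gamma_kernel (x + 1) t)%:E =
   (a `^ x * expR (- a) - b `^ x * expR (- b))%:E +
   x%:E * \int[mu]_(t in `[a, b]) (gamma_kernel x t)%:E)%E.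
Proof.
move=> a0 ab.
have pos t : t \in `[a, b] -> 0 < t.
  by rewrite in_itv/= => /andP[at_ _]; exact: lt_le_trans at_.
have cE : continuous (fun u : R => expR (- u)).
  move=> u; apply: continuous_comp; first exact: continuousN.
  exact: continuous_expR.
have cP y : {within `[a, b], continuous (@powR R ^~ y)}.
  by apply: continuous_in_subspaceT => t /set_mem/= /pos; exact: continuous_powR.
transitivity (\int[mu]_(t in `[a, b]) (t `^ x * expR (- t))%:E)%E.
  by apply: eq_integral => t _; rewrite /gamma_kernel addrK.
rewrite (@integration_by_parts R (@powR R ^~ x) (fun u => - expR (- u))
  (fun u => x * u `^ (x - 1)) (fun u => expR (- u)) a b ab).
- congr (_ + _)%E; first by rewrite !mulrN opprK addrC.
  transitivity (- \int[mu]_(t in `[a, b]) ((- x)%:E * (gamma_kernel x t)%:E))%E.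
    congr (- _)%E; apply: eq_integral => t _.
    by rewrite -EFinM mulrN mulNr mulrA.
  rewrite integralZl//; first by rewrite EFinN mulNe oppeK.
  apply: continuous_compact_integrable; first exact: segment_compact.
  apply: continuous_in_subspaceT => t /set_mem/= /pos t0.
  by apply: cvgM; [exact: continuous_powR|exact: cE].
- apply: continuous_in_subspaceT => t /set_mem/= /pos t0.
  by apply: cvgM; [exact: cvg_cst|exact: continuous_powR].
- split.
  + by move=> t /subset_itv_oo_cc/pos t0; apply: derivable_powR; rewrite in_itv/= t0.
  + apply: cvg_at_right_filter; exact: continuous_powR.
  + apply: cvg_at_left_filter; apply: continuous_powR; exact: lt_trans ab.
- by move=> t /subset_itv_oo_cc/pos t0; rewrite powR_derive1// in_itv/= t0.
- exact: continuous_subspaceT.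
- split.
  + by move=> t _; apply: ex_derive; apply: is_deriveN; exact: is_derive_expRN.
  + by apply: cvg_at_right_filter; apply: cvgN; exact: cE.
  + by apply: cvg_at_left_filter; apply: cvgN; exact: cE.
- move=> t _; rewrite derive1E.
  have -> := @derive_val _ _ _ _ _ _ _ (is_deriveN (is_derive_expRN t)).
  by rewrite opprK.
Qed.

(** The index starts at 2 so that the end points are always distinct. *)
Definition gamma_segment n : set R := `[n.+2%:R^-1, n.+2%:R]%classic.

Lemma cvg_gamma_segment x :
  (\int[mu]_(t in gamma_segment n) (gamma_kernel x t)%:E)%E @[n --> \oo]
  --> eGamma x.
Proof.
have -> : eGamma x =
    (\int[mu]_(t in \bigcup_n gamma_segment n) (gamma_kernel x t)%:E)%E.
  congr (integral _ _ _); apply/seteqP; split => t /=.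
    rewrite in_itv/= andbT => t0.
    exists (Num.trunc (Num.max t t^-1)) => //=; rewrite /gamma_segment/= in_itv/=.
    have h : Num.max t t^-1 < (Num.trunc (Num.max t t^-1)).+2%:R.
      by apply: lt_trans (truncnS_gt _) _; rewrite ltr_nat.
    apply/andP; split; last by apply/ltW/le_lt_trans/h; rewrite le_max lexx.
    rewrite -[leRHS]invrK lef_pV2 ?posrE ?invr_gt0//.
    by apply/ltW/le_lt_trans/h; rewrite le_max lexx orbT.
  by move=> [n _]; rewrite /gamma_segment/= !in_itv/= andbT => /andP[+ _]; apply: lt_le_trans.
apply: ge0_nondecreasing_set_cvg_integral => //=.
- move=> m n mn; apply/subsetPset => t; rewrite /gamma_segment/= !in_itv/= => /andP[mt tm].
  rewrite (le_trans _ mt)/= ?(le_trans tm) ?ler_nat//.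
  by rewrite lef_pV2 ?posrE// ler_nat.
- by move=> n; exact: measurable_itv.
- by move=> n; exact: measurable_EFin_gamma_kernel.
- by move=> n t _; rewrite lee_fin gamma_kernel_ge0.
Qed.

Lemma eGamma_ge0 x : (0 <= eGamma x)%E.
Proof. by apply: integral_ge0 => t _; rewrite lee_fin gamma_kernel_ge0. Qed.

(** Limit of the integrations by parts on the segments: their boundary terms
    vanish, and monotone convergence takes care of the integrals, finite or
    not. *)
Lemma eGammaS x : 0 < x -> eGamma (x + 1) = (x%:E * eGamma x)%E.
Proof.
move=> x0; apply: cvg_unique (@cvg_gamma_segment (x + 1)) _ => /=.
  exact: ereal_hausdorff.
have n01 n : (n.+2%:R^-1 : R) < n.+2%:R.
  by apply: (@lt_trans _ _ 1); rewrite ?invf_lt1 ?ltr1n.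
have H : ((n.+2%:R^-1 `^ x * expR (- n.+2%:R^-1)
           - n.+2%:R `^ x * expR (- n.+2%:R))%:E +
   x%:E * \int[mu]_(t in gamma_segment n) (gamma_kernel x t)%:E)%E
   @[n --> \oo] --> (x%:E * eGamma x)%E; last first.
  under eq_cvg => n do rewrite /gamma_segment gamma_kernel_by_parts ?invr_gt0//.
  exact: H.
rewrite -[X in _ --> X]add0e.
apply: cvgeD => //.
  rewrite -[X in _ --> X]/((0%R)%:E) -(subrr (0 : R)).
  apply: cvg_EFin; first exact: nearW.
  apply: cvgB.
    by have := gamma_boundary_0 x0; rewrite -cvg_shiftS.
  by have := gamma_boundary_pinfty x; rewrite -cvg_shiftS.
apply: cvgeZl => //; exact: cvg_gamma_segment.
Qed.

Lemma eGamma1 : eGamma 1 = 1%E.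
Proof.
transitivity (\int[mu]_(t in `[0%R, +oo[) (expR (- t))%:E)%E.
  rewrite -integral_itv_obnd_cbnd.
    by apply: eq_integral => t _; rewrite /gamma_kernel subrr powRr0 mul1r.
  apply/measurable_EFinP; apply: measurableT_comp => //; exact: measurable_expR.
have cE : continuous (fun u : R => expR (- u)).
  move=> u; apply: continuous_comp; first exact: continuousN.
  exact: continuous_expR.
rewrite (@ge0_continuous_FTC2y R (fun t => expR (- t)) (fun t => - expR (- t)) 0 0).
- by rewrite oppr0 expR0 EFinN oppeK add0e.
- by move=> t _; exact: expR_ge0.
- exact: continuous_subspaceT.
- by rewrite -oppr0; apply: cvgN; exact: cvgr_expR.
- by move=> t _; apply: ex_derive; apply: is_deriveN; exact: is_derive_expRN.
- by apply: cvg_at_right_filter; apply: cvgN; exact: cE.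
- move=> t _; rewrite derive1E.
  have -> := @derive_val _ _ _ _ _ _ _ (is_deriveN (is_derive_expRN t)).
  by rewrite opprK.
Qed.

(** The value at 1 and the functional equation give convergence at the positive
    integers.  For y >= 1 the kernel is at most the sum of those of 1 and of an
    integer above y, and for x < 1 the functional equation deduces convergence
    from that at x + 1; the singularity at 0 is never estimated. *)
Lemma eGamma_fin_num x : 0 < x -> eGamma x \is a fin_num.
Proof.
suff main y : 1 <= y -> eGamma y \is a fin_num.
  move=> x0.
  have -> : eGamma x = (x^-1%:E * eGamma (x + 1))%E.
    by rewrite eGammaS// muleA -EFinM mulVf ?gt_eqF// mul1e.
  by rewrite fin_numM// main// lerDr ltW.
move=> y1.
have fin_nat n : eGamma n.+1%:R \is a fin_num.
  elim: n => [|n IH]; first by rewrite eGamma1.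
  by rewrite -[n.+2%:R]natr1 eGammaS// fin_numM.
have [k ky] : exists k : nat, y <= k.+1%:R.
  by exists (Num.trunc y); apply/ltW/truncnS_gt.
rewrite ge0_fin_numE ?eGamma_ge0//.
apply: (@le_lt_trans _ _ (eGamma 1 + eGamma k.+1%:R)%E); last first.
  by rewrite lte_add_pinfty// -ge0_fin_numE ?eGamma_ge0// eGamma1.
rewrite /eGamma -ge0_integralD//=; last 4 first.
- by move=> t _; rewrite lee_fin gamma_kernel_ge0.
- exact: measurable_EFin_gamma_kernel.
- by move=> t _; rewrite lee_fin gamma_kernel_ge0.
- exact: measurable_EFin_gamma_kernel.
apply: ge0_le_integral => //=.
- by move=> t _; rewrite lee_fin gamma_kernel_ge0.
- exact: measurable_EFin_gamma_kernel.
- by apply: emeasurable_funD; exact: measurable_EFin_gamma_kernel.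
move=> t; rewrite in_itv/= andbT => t0.
rewrite -EFinD lee_fin /gamma_kernel -mulrDl ler_pM2r ?expR_gt0//.
rewrite subrr powRr0.
have [t1|t1] := leP t 1.
  rewrite -[leLHS]addr0 lerD ?powR_ge0// -[leRHS](powRr0 t).
  by apply: ger_powR; rewrite ?t0 ?t1 ?subr_ge0.
apply: (@le_trans _ _ (t `^ (k.+1%:R - 1))); last by rewrite lerDr.
by apply: ler_powR; rewrite ?(ltW t1)// lerD2r.
Qed.

Lemma EFin_Gamma x : 0 < x -> (Gamma x)%:E = eGamma x.
Proof. by move=> x0; rewrite fineK// eGamma_fin_num. Qed.

Lemma GammaS x : 0 < x -> Gamma (x + 1) = x * Gamma x.
Proof.
move=> x0; apply: EFin_inj; rewrite EFinM !EFin_Gamma ?addr_gt0//.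
exact: eGammaS.
Qed.

Lemma Gamma1 : Gamma (1 : R) = 1.
Proof. by apply: EFin_inj; rewrite EFin_Gamma// eGamma1. Qed.

(** For y >= 1 the kernel is at least exp (-2) on [1, 2]; the functional
    equation extends positivity to x < 1. *)
Lemma Gamma_gt0 x : 0 < x -> 0 < Gamma x.
Proof.
suff main (y : R) : 1 <= y -> 0 < Gamma y.
  move=> x0; have := main (x + 1); rewrite GammaS// pmulr_rgt0//; apply.
  by rewrite lerDr ltW.
move=> y1; have y0 : 0 < y by exact: lt_le_trans y1.
apply: (@lt_le_trans _ _ (expR (- 2))); first exact: expR_gt0.
rewrite -lee_fin EFin_Gamma//.
apply: (@le_trans _ _ (\int[mu]_(t in `[1%R, 2%R]) (expR (- 2))%:E)%E).
  rewrite integral_cst//= lebesgue_measure_itv/= lte_fin ltr1n.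
  by rewrite -EFinB -EFinM lee_fin ler_pMr ?expR_gt0//; lra.
apply: (@le_trans _ _ (\int[mu]_(t in `[1%R, 2%R]) (gamma_kernel y t)%:E)%E).
  apply: ge0_le_integral => //=.

  - exact: measurable_EFin_gamma_kernel.
  move=> t; rewrite in_itv/= => /andP[t1 t2].
  rewrite lee_fin /gamma_kernel -[leLHS]mul1r ler_pM ?expR_ge0//.
    by rewrite -[leLHS](powRr0 t) ler_powR// subr_ge0.
  by rewrite ler_expR lerN2.
apply: ge0_subset_integral => //=.
- exact: measurable_EFin_gamma_kernel.
- by move=> t _; rewrite lee_fin gamma_kernel_ge0.
- move=> t /=; rewrite !in_itv/= andbT => /andP[+ _]; exact: lt_le_trans.
Qed.

Lemma Gamma_le_lincomb (u v z A B : R) : 0 < u -> 0 < v -> 0 < z ->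
  0 <= A -> 0 <= B ->
  (forall t, 0 < t ->
     gamma_kernel z t <= A * gamma_kernel u t + B * gamma_kernel v t) ->
  Gamma z <= A * Gamma u + B * Gamma v.
Proof.
move=> u0 v0 z0 A0 B0 h.
move: (EFin_Gamma u0) (EFin_Gamma v0) (EFin_Gamma z0).
generalize (Gamma u), (Gamma v), (Gamma z) => gu gv gz gu_ gv_ gz_.
rewrite -lee_fin EFinD !EFinM gu_ gv_ gz_ /eGamma.
have k0 (x t : R) : (0 <= (gamma_kernel x t)%:E)%E.
  by rewrite lee_fin gamma_kernel_ge0.
rewrite -!ge0_integralZl//=; try exact: measurable_EFin_gamma_kernel.
have mk (C x : R) (D : set R) :
    measurable_fun D (fun t : R => (C%:E * (gamma_kernel x t)%:E)%E).
  apply/measurable_EFinP; apply: measurable_funM => //.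
  exact: measurable_gamma_kernel.
have mk0 (C x : R) (D : set R) :
    0 <= C -> forall t : R, D t -> (0 <= C%:E * (gamma_kernel x t)%:E)%E.
  by move=> C0 t _; rewrite mule_ge0// lee_fin.
rewrite -ge0_integralD//=; try exact: mk; try exact: (mk0 _ _ `]0, +oo[%classic).
apply: ge0_le_integral => //=.
- exact: measurable_EFin_gamma_kernel.
- by apply: emeasurable_funD; exact: mk.
by move=> t; rewrite in_itv/= andbT => /h; rewrite -!EFinM -EFinD lee_fin.
Qed.

(** The exponential lies above its tangent at the barycentre. *)
Lemma expR_jensen (l m A B : R) : 0 <= l -> 0 <= m -> l + m = 1 ->
  expR (l * A + m * B) <= l * expR A + m * expR B.
Proof.
move=> l0 m0 lm; set C := l * A + m * B.
have tangent (x : R) : expR C * (1 + (x - C)) <= expR x.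
  have -> : expR x = expR C * expR (x - C) by rewrite -expRD subrKC.
  rewrite ler_pM2l ?expR_gt0//.
  exact: expR_ge1Dx.
have -> : expR C = l * (expR C * (1 + (A - C))) + m * (expR C * (1 + (B - C))).
  have mE : m = 1 - l by rewrite -lm addrC addKr.
  by move: (expR C) => e; rewrite /C mE; ring.
by rewrite lerD// ler_wpM2l.
Qed.

(** Hölder's inequality, obtained by integrating the convexity of the
    exponential applied to the kernels of u and v divided by their integrals. *)
Lemma lnGamma_convex (u z v : R) : 0 < u -> u < z -> z < v ->
  (v - u) * ln (Gamma z) <= (v - z) * ln (Gamma u) + (z - u) * ln (Gamma v).
Proof.
move=> u0 uz zv.
have z0 : 0 < z by exact: lt_trans uz.
have v0 : 0 < v by exact: lt_trans zv.
move: (fun A B => @Gamma_le_lincomb u v z A B u0 v0 z0).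
move: (Gamma_gt0 u0) (Gamma_gt0 v0) (Gamma_gt0 z0).
generalize (Gamma u), (Gamma v), (Gamma z) => gu gv gz gu0 gv0 gz0 lincomb.
have vu : 0 < v - u by rewrite subr_gt0 (lt_trans uz).
set l := (v - z) / (v - u); set m := (z - u) / (v - u).
have l0 : 0 <= l by rewrite divr_ge0// ltW// subr_gt0.
have m0 : 0 <= m by rewrite divr_ge0// ltW// subr_gt0.
have lm : l + m = 1 by rewrite /l /m; field; rewrite gt_eqF.
have lmz : l * u + m * v = z by rewrite /l /m; field; rewrite gt_eqF.
set M := l * ln (gu) + m * ln (gv).
suff : gz <= expR M.
  rewrite -ler_ln ?posrE ?expR_gt0// expRK => h.
  have -> : (v - z) * ln (gu) + (z - u) * ln (gv) = (v - u) * M.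
    rewrite /M /l /m.
    by field; rewrite gt_eqF.
  by rewrite ler_pM2l.
have -> : expR M = expR M * l / gu * gu + expR M * m / gv * gv.
  by rewrite !divfK ?gt_eqF// -mulrDr lm mulr1.
apply: lincomb.
- by apply: divr_ge0 (mulr_ge0 (expR_ge0 _) l0) (ltW gu0).
- by apply: divr_ge0 (mulr_ge0 (expR_ge0 _) m0) (ltW gv0).
move=> t t0.
have kE (x : R) : gamma_kernel x t = expR ((x - 1) * ln t - t).
  by rewrite /gamma_kernel /powR gt_eqF// expRD.
have := @expR_jensen l m ((u - 1) * ln t - t - ln (gu))
  ((v - 1) * ln t - t - ln (gv)) l0 m0 lm.
rewrite [X in expR X](_ : _ = (z - 1) * ln t - t - M); last first.
  rewrite /M -lmz; have -> : m = 1 - l by rewrite -lm addrC addKr.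
  by ring.
rewrite !(expRB _ (ln _)) (expRB _ M) !lnK ?posrE// -!kE.
rewrite ler_pdivrMr ?expR_gt0// => /le_trans; apply.
by rewrite le_eqVlt; apply/orP; left; apply/eqP; ring.
Qed.

End GammaIntegral.

(** * Derivatives of pointwise limits *)

Section PointwiseDerivatives.
Context {R : realType}.
Implicit Types (f g : R -> R) (x c : R).

Lemma is_derive_constf c x : is_derive x 1 (fun=> c) 0.
Proof. exact: is_derive_cst. Qed.

Lemma is_derive_idf x : is_derive x 1 (fun y : R => y) 1.
Proof. exact: is_derive_id. Qed.

Lemma is_derive_addf f g x df dg : is_derive x 1 f df -> is_derive x 1 g dg ->
  is_derive x 1 (fun y => f y + g y) (df + dg).
Proof. by move=> hf hg; exact: is_deriveD hf hg. Qed.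

Lemma is_derive_oppf f x df : is_derive x 1 f df -> is_derive x 1 (fun y => - f y) (- df).
Proof. by move=> hf; exact: is_deriveN hf. Qed.

Lemma is_derive_subf f g x df dg : is_derive x 1 f df -> is_derive x 1 g dg ->
  is_derive x 1 (fun y => f y - g y) (df - dg).
Proof. by move=> hf hg; exact: is_deriveB hf hg. Qed.

Lemma is_derive_mulf f g x df dg : is_derive x 1 f df -> is_derive x 1 g dg ->
  is_derive x 1 (fun y => f y * g y) (f x * dg + g x * df).
Proof. by move=> hf hg; exact: is_deriveM hf hg. Qed.

Lemma is_derive_scalef c f x df : is_derive x 1 f df ->
  is_derive x 1 (fun y => c * f y) (c * df).
Proof. by move=> hf; exact: is_deriveZ hf. Qed.

Lemma is_derive_invf f x df : f x != 0 -> is_derive x 1 f df ->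
  is_derive x 1 (fun y => (f y)^-1) (- (df / f x ^+ 2)).
Proof.
move=> f0 hf; apply: is_derive_eq (is_deriveV f0 hf) _.
by rewrite /GRing.scale/= mulNr mulrC.
Qed.

Lemma is_derive_compf f g x df dg : is_derive (g x) 1 f df -> is_derive x 1 g dg ->
  is_derive x 1 (fun y => f (g y)) (df * dg).
Proof. by move=> hf hg; exact: (is_derive1_comp hf hg). Qed.

Lemma is_derive_shiftf c f x df : is_derive (x + c) 1 f df ->
  is_derive x 1 (fun y => f (y + c)) df.
Proof.
move=> h; have D := is_derive_addf (is_derive_idf x) (is_derive_constf c x).
have := @is_derive_compf f (fun y => y + c) x _ _ h D.
by rewrite addr0 mulr1.
Qed.

Lemma is_derive_sumf n (f df : nat -> R -> R) x :
  (forall k, is_derive x 1 (f k) (df k x)) ->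
  is_derive x 1 (fun y => \sum_(k < n) f k y) (\sum_(k < n) df k x).
Proof.
move=> h; have -> : (fun y => \sum_(k < n) f k y) = \sum_(k < n) f k.
  by apply/funext => y; rewrite fct_sumE.
exact: is_derive_sum.
Qed.

Lemma is_derive_expVn j x : x != 0 ->
  is_derive x 1 (fun y : R => (y ^+ j)^-1) (- (j%:R * (x ^+ j.+1)^-1)).
Proof.
move=> x0.
have D : is_derive x 1 (fun y : R => y ^+ j) (j%:R * x ^+ j.-1).
  by have := is_deriveX j (is_derive_id x (1 : R)); rewrite exprfctE /GRing.scale/= mulr1.
have H := @is_derive_invf (fun y => y ^+ j) x _ (expf_neq0 j x0) D.
apply: is_derive_eq H _.
case: j {D} => [|j]; first by rewrite !mul0r oppr0.
by rewrite /= !exprS; field; rewrite ?x0 ?expf_neq0.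
Qed.

End PointwiseDerivatives.

Section DerivativeLimit.
Context {R : realType}.
Implicit Types (f df d2f : R -> R) (x y r M : R).

Lemma is_derive_continuous f x d : is_derive x 1 f d -> {for x, continuous f}.
Proof. by case=> /derivable1_diffP/differentiable_continuous. Qed.

Lemma mean_value f df a b : a < b ->
  (forall x, a <= x <= b -> is_derive x 1 f (df x)) ->
  exists2 c, a < c < b & f b - f a = df c * (b - a).
Proof.
move=> ab h.
have [||c] := @MVT _ f df a b ab.
- by move=> x; rewrite in_itv/= => /andP[/ltW ? /ltW ?]; apply: h; apply/andP.
- apply: continuous_in_subspaceT => x /set_mem/=; rewrite in_itv/= => xab.
  exact: is_derive_continuous (h x xab).
by rewrite in_itv/= => cab e; exists c.
Qed.

(** The cruder constant M, instead of M / 2, needs only the mean value theorem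
    twice. *)
Lemma taylor1_bound f df d2f r M :
  (forall x, r <= x -> is_derive x 1 f (df x)) ->
  (forall x, r <= x -> is_derive x 1 df (d2f x)) ->
  (forall x, r <= x -> `|d2f x| <= M) ->
  forall x y, r <= x -> r <= y ->
  `|f y - f x - (y - x) * df x| <= M * (y - x) ^+ 2.
Proof.
move=> hf hdf hM.
have mv g dg : (forall x, r <= x -> is_derive x 1 g (dg x)) ->
    forall x y, r <= x -> r <= y -> exists c, [/\ r <= c,
      `|c - x| <= `|y - x| & g y - g x = (y - x) * dg c].
  move=> hg x y rx ry; have [xy|yx|->] := ltgtP x y.
  - have [z|c /andP[xc cy] e] := @mean_value g dg x y xy.
      by move=> /andP[xz _]; apply: hg; exact: le_trans xz.
    exists c; split; [by apply: ltW (le_lt_trans rx xc)| |by rewrite e mulrC].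
    by rewrite !gtr0_norm ?subr_gt0// lerD2r ltW.
  - have [z|c /andP[yc cx] e] := @mean_value g dg y x yx.
      by move=> /andP[yz _]; apply: hg; exact: le_trans yz.
    exists c; split; first by apply: ltW (le_lt_trans ry yc).
      by rewrite !ltr0_norm ?subr_lt0// lerN2 lerD2r ltW.
    by rewrite -opprB e mulrC -mulNr opprB.
  - by exists y; split=> //; rewrite !subrr mul0r.
move=> x y rx ry.
have [c [rc cxy ->]] := mv _ _ hf x y rx ry.
have [c' [rc' _ e]] := mv _ _ hdf x c rx rc.
rewrite -mulrBr e mulrA !normrM -real_normK ?num_real// mulrC.
rewrite expr2 ler_pM ?mulr_ge0 ?hM//.
by rewrite ler_wpM2l.
Qed.

(** The converse of the Taylor bound: a quadratic error identifies the
    derivative. *)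
Lemma is_derive_quadratic f x d r M : 0 < r ->
  (forall y, `|y - x| < r -> `|f y - f x - (y - x) * d| <= M * (y - x) ^+ 2) ->
  is_derive x 1 f d.
Proof.
move=> r0 h; apply/is_derive1_caratheodory.
exists (fun z => if z == x then d else (f z - f x) / (z - x)); split.
- move=> z; case: eqVneq => [->|zx]; first by rewrite !subrr mulr0.
  by rewrite divfK// subr_eq0.
- rewrite /prop_for /continuous_at /= eqxx; apply/cvgrPdist_le => e e0.
  have M0 : 0 < `|M| + 1 by rewrite ltr_wpDl.
  near=> z; case: eqVneq => [_|zx]; first by rewrite subrr normr0 ltW.
  have zx0 : z - x != 0 by rewrite subr_eq0.
  have zr : `|z - x| < r by near: z; apply: (@cvgr_distC_lt _ _ _ _ _ id).
  have ze : `|z - x| <= e / (`|M| + 1).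
    by near: z; apply: (@cvgr_distC_le _ _ _ _ _ id); rewrite ?divr_gt0.
  have -> : d - (f z - f x) / (z - x) = - ((f z - f x - (z - x) * d) / (z - x)).
    by field.
  rewrite normrN normrM normfV ler_pdivrMr ?normr_gt0//.
  apply: le_trans (h z zr) _.
  rewrite -real_normK ?num_real// expr2 mulrA ler_pM2r ?normr_gt0//.
  rewrite ler_pdivlMr// in ze; apply: le_trans ze.
  rewrite mulrC ler_wpM2l//; apply: le_trans (ler_norm M) _.
  by rewrite lerDl.
- by rewrite eqxx.
Unshelve. all: by end_near. Qed.

(** Each f n is within M h^2 of its tangent, uniformly in n.  Hence the slopes
    df n x are within M h of difference quotients that converge, so they form a
    Cauchy sequence, and the bound survives in the limit.  No convergence of the
    derivatives has to be assumed, which is what allows iteration. *)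
Lemma derivative_of_limit (f df d2f : nat -> R -> R) (F : R -> R) :
  (forall n x, 0 < x -> is_derive x 1 (f n) (df n x)) ->
  (forall n x, 0 < x -> is_derive x 1 (df n) (d2f n x)) ->
  (forall r, 0 < r -> exists M, forall n x, r <= x -> `|d2f n x| <= M) ->
  (forall x, 0 < x -> f n x @[n --> \oo] --> F x) ->
  forall x, 0 < x ->
  is_derive x 1 F (derive1 F x) /\ (df n x @[n --> \oo] --> derive1 F x).
Proof.
move=> hf hdf hM hF x x0.
have r0 : 0 < x / 2 by rewrite divr_gt0.
have [M HM] := hM _ r0.
have M0 : 0 <= M by apply: le_trans (HM 0%N x _); rewrite ?normr_ge0//; lra.
have rx : x / 2 <= x by lra.
have bound n y : x / 2 <= y ->
    `|f n y - f n x - (y - x) * df n x| <= M * (y - x) ^+ 2.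
  move=> ry; apply: (@taylor1_bound (f n) (df n) (d2f n) (x / 2) M _ _ _ x y rx ry) => z rz.
  - by apply: hf; exact: lt_le_trans rz.
  - by apply: hdf; exact: lt_le_trans rz.
  - exact: HM.
have cdf : cvgn (fun n => df n x).
  apply: cauchy_cvg; apply: cauchy_exP => e e0 /=.
  pose h := e / 2 / (M + 1).
  have M1 : 0 < M + 1 by rewrite ltr_wpDl.
  have h0 : 0 < h by rewrite !divr_gt0.
  exists ((F (x + h) - F x) / h).
  have xh0 : 0 < x + h by rewrite addr_gt0.
  have lim : (f n (x + h) - f n x) / h @[n --> \oo] --> (F (x + h) - F x) / h.
    by apply: cvgMl; apply: cvgB; exact: hF.
  near=> n; rewrite /= /ball/=.
  have e1 : `|(F (x + h) - F x) / h - (f n (x + h) - f n x) / h| < e / 2.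
    by near: n; apply: (cvgr_dist_lt _ _ lim); rewrite divr_gt0.
  have e2 : `|(f n (x + h) - f n x) / h - df n x| <= e / 2.
    have b : `|f n (x + h) - f n x - h * df n x| <= M * h ^+ 2.
      by have := bound n (x + h); rewrite [x + h - x]addrC addKr; apply; lra.
    have -> : (f n (x + h) - f n x) / h - df n x =
        (f n (x + h) - f n x - h * df n x) / h by field; rewrite gt_eqF.
    rewrite normrM normfV (gtr0_norm h0) ler_pdivrMr//; apply: (le_trans b).
    rewrite expr2 mulrA ler_pM2r// /h mulrCA ler_piMr ?divr_ge0 ?ltW//.
    by rewrite ltr_pdivrMr// mul1r ltrDl.
  have -> : (F (x + h) - F x) / h - df n x =
    ((F (x + h) - F x) / h - (f n (x + h) - f n x) / h) +
    ((f n (x + h) - f n x) / h - df n x) by ring.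
  by rewrite [ltRHS]splitr (le_lt_trans (ler_normD _ _))// ltr_leD.
have : is_derive x 1 F (limn (fun n => df n x)).
  apply: (@is_derive_quadratic _ _ _ (x / 2) M) => // y yx.
  have ry : x / 2 <= y by move: yx; rewrite ltr_norml => /andP[]; lra.
  have y0 : 0 < y by exact: lt_le_trans ry.
  have L : `|f n y - f n x - (y - x) * df n x| @[n --> \oo] -->
      `|F y - F x - (y - x) * limn (fun n => df n x)|.
    apply: cvg_norm; apply: cvgB; first by apply: cvgB; exact: hF.
    exact: cvgMr.
  rewrite -(cvg_lim _ L)//; apply: limr_le; first by apply/cvg_ex; eexists; exact: L.
  by apply: nearW => n; exact: bound.
move=> D; have E : derive1 F x = limn (fun n => df n x) by rewrite derive1E derive_val.
by rewrite E.
Unshelve. all: by end_near. Qed.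

End DerivativeLimit.

(** * The Bohr-Mollerup limit and the polygamma functions *)

Lemma unroll_recurrence {R : realType} (F g : R -> R) (y : R) n : 0 < y ->
  (forall z : R, 0 < z -> F (z + 1) = F z + g z) ->
  F (y + n%:R) = F y + \sum_(k < n) g (y + k%:R).
Proof.
move=> y0 FS; elim: n => [|n IH]; first by rewrite big_ord0 !addr0.
by rewrite -natr1 addrA FS ?ltr_wpDr// IH big_ord_recr addrA.
Qed.

Section LogConvexFactorial.
Context {R : realType}.
Implicit Types (x y : R) (n : nat).
Variable f : R -> R.
Hypothesis fS : forall x, 0 < x -> f (x + 1) = f x + ln x.
Hypothesis f_convex : forall u z v, 0 < u -> u < z -> z < v ->
  (v - u) * f z <= (v - z) * f u + (z - u) * f v.

(** The logarithm of Gauss's product N^x (N - 1)! / (x (x + 1) ... (x + N - 1))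
    with N = n + 2, where f N stands for ln ((N - 1)!). *)
Definition gauss_approx n x : R :=
  f n.+2%:R + x * ln n.+2%:R - \sum_(k < n.+2) ln (x + k%:R).

(** By convexity the slope of f between N and N + x, with N = n + 2, lies
    between the slopes over [N - 1, N] and over [N + x, N + x + 1].  The
    functional equation computes those as ln (N - 1) and ln (N + x), and both are
    close to ln N.  Any x > 0 is allowed, so no reduction to (0, 1] is needed. *)
Lemma gauss_approx_error n x : 0 < x ->
  `|gauss_approx n x - f x| <= (x + x ^+ 2) * n.+1%:R^-1.
Proof.
move=> x0.
have n1 : 0 < n.+1%:R :> R by [].
have n2 : 0 < n.+2%:R :> R by [].
have E2 : n.+2%:R = n.+1%:R + 1 :> R by rewrite natr1.
have -> : gauss_approx n x - f x =
    - (f (n.+2%:R + x) - f n.+2%:R - x * ln n.+2%:R).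
  by rewrite /gauss_approx [_%:R + x]addrC (unroll_recurrence _ x0 fS); ring.
rewrite normrN.
have up : f (n.+2%:R + x) - f n.+2%:R <= x * ln (n.+2%:R + x).
  have nx0 : 0 < n.+2%:R + x by rewrite addr_gt0.
  have := @f_convex n.+2%:R (n.+2%:R + x) (n.+2%:R + x + 1) n2.
  rewrite ltrDl x0 ltrDl ltr01 => /(_ isT isT); rewrite fS//.
  rewrite -subr_ge0 -[_ <= x * _]subr_ge0 => h; apply: le_trans h _.
  by rewrite le_eqVlt; apply/orP; left; apply/eqP; ring.
have lo : x * ln n.+1%:R <= f (n.+2%:R + x) - f n.+2%:R.
  have := @f_convex n.+1%:R n.+2%:R (n.+2%:R + x) n1.
  rewrite ltr_nat ltnS leqnn ltrDl x0=> /(_ isT isT).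
  have -> : f n.+1%:R = f n.+2%:R - ln n.+1%:R.
    by rewrite E2 fS// addrK.
  rewrite -subr_ge0 -[x * _ <= _]subr_ge0 => h; apply: le_trans h _.
  by rewrite le_eqVlt; apply/orP; left; apply/eqP; rewrite E2; ring.
have up' : ln (n.+2%:R + x) - ln n.+2%:R <= x / n.+1%:R.
  rewrite -ln_div ?posrE ?addr_gt0// mulrDl divff ?gt_eqF//.
  apply: (@le_trans _ _ (x / n.+2%:R)).
    by apply: le_ln1Dx; rewrite (@lt_trans _ _ 0)// ?divr_gt0// ltrN10.
  by rewrite ler_pM2l// lef_pV2 ?posrE// ler_nat.
have lo' : ln n.+2%:R - ln n.+1%:R <= n.+1%:R^-1 :> R.
  rewrite -ln_div ?posrE// E2 mulrDl divff ?gt_eqF// mul1r.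
  by apply: le_ln1Dx; rewrite (@lt_trans _ _ 0)// ?invr_gt0// ltrN10.
have lox : x * ln n.+2%:R - x * ln n.+1%:R <= x * n.+1%:R^-1.
  by rewrite -mulrBr ler_pM2l.
have upx : x * ln (n.+2%:R + x) - x * ln n.+2%:R <= x * (x / n.+1%:R).
  by rewrite -mulrBr ler_pM2l.
have p1 : 0 <= x * n.+1%:R^-1 by rewrite mulr_ge0 ?invr_ge0 ?ltW.
have p2 : 0 <= x * (x / n.+1%:R) by rewrite !mulr_ge0 ?invr_ge0 ?ltW.
have -> : (x + x ^+ 2) * n.+1%:R^-1 = x * n.+1%:R^-1 + x * (x / n.+1%:R) by ring.
rewrite ler_norml; move: up lo lox upx p1 p2.
move: (x * (x / n.+1%:R)) (x * n.+1%:R^-1) => p q.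
move: (x * ln (n.+2%:R + x)) (x * ln n.+2%:R) (x * ln n.+1%:R) => a b c.
by move: (f (n.+2%:R + x)) (f n.+2%:R) => s t *; apply/andP; split; lra.
Qed.

End LogConvexFactorial.

Section BohrMollerup.
Context {R : realType}.
Implicit Types (x y r : R) (n j : nat).

Definition lnGamma x : R := ln (Gamma x).

Lemma lnGammaS x : 0 < x -> lnGamma (x + 1) = lnGamma x + ln x.
Proof.
by move=> x0; rewrite /lnGamma GammaS// lnM ?posrE ?Gamma_gt0// addrC.
Qed.

Definition shifted_power_sum j n x : R := \sum_(k < n) ((x + k%:R) ^+ j)^-1.

Lemma is_derive_shifted_power_sum j n x : 0 < x ->
  is_derive x 1 (shifted_power_sum j n) (- (j%:R * shifted_power_sum j.+1 n x)).
Proof.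
move=> x0; rewrite /shifted_power_sum mulr_sumr -sumrN.
apply: (@is_derive_sumf _ n (fun k y => ((y + k%:R) ^+ j)^-1)
  (fun k y => - (j%:R * ((y + k%:R) ^+ j.+1)^-1))) => k.
apply: (@is_derive_shiftf _ k%:R (fun z => (z ^+ j)^-1)).
by apply: is_derive_expVn; rewrite gt_eqF// ltr_wpDr.
Qed.

Lemma shifted_power_sum_ge0 j n x : 0 < x -> 0 <= shifted_power_sum j n x.
Proof.
move=> x0; apply: sumr_ge0 => k _.
by rewrite invr_ge0 exprn_ge0// addr_ge0// ltW.
Qed.

(** With n + 1 terms the bound is improved by 1 / (x + n), which makes the
    induction work: 1 / y^2 is at most 1 / (y - 1) - 1 / y. *)
Lemma shifted_power_sum2_le n x : 0 < x ->
  shifted_power_sum 2 n x <= (x ^+ 2)^-1 + x^-1.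
Proof.
move=> x0; case: n => [|n].
  by rewrite /shifted_power_sum big_ord0 addr_ge0 ?invr_ge0 ?exprn_ge0 ?ltW.
apply: (@le_trans _ _ ((x ^+ 2)^-1 + x^-1 - (x + n%:R)^-1)); last first.
  by rewrite lerBlDr lerDl invr_ge0 addr_ge0// ltW.
elim: n => [|n].
  by rewrite /shifted_power_sum big_ord_recr big_ord0 /= !addr0 add0r addrK.
rewrite /shifted_power_sum [X in _ -> X <= _]big_ord_recr/= => /lerD h.
apply: le_trans (h _ _ (lexx _)) _; rewrite -!addrA !lerD2l -[n.+1%:R]natr1 addrA.
have : 0 < x + n%:R by rewrite ltr_wpDr.
move: (x + n%:R) => y y0; have y1 : 0 < y + 1 by rewrite addr_gt0.
rewrite -subr_ge0.
have -> : - (y + 1)^-1 - (- y^-1 + ((y + 1) ^+ 2)^-1) = (y * (y + 1) ^+ 2)^-1.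
  by field; rewrite !gt_eqF.
by rewrite invr_ge0 mulr_ge0 ?exprn_ge0 ?ltW.
Qed.

Lemma shifted_power_sum_bounded j r : 0 < r ->
  exists M, forall n x, r <= x -> `|shifted_power_sum j.+2 n x| <= M.
Proof.
move=> r0; exists ((r ^+ j)^-1 * ((r ^+ 2)^-1 + r^-1)) => n x rx.
have x0 : 0 < x by exact: lt_le_trans rx.
rewrite ger0_norm ?shifted_power_sum_ge0//.
apply: (@le_trans _ _ ((r ^+ j)^-1 * shifted_power_sum 2 n x)).
  rewrite /shifted_power_sum mulr_sumr; apply: ler_sum => k _.
  rewrite -[j.+2]addn2 exprD invfM ler_wpM2r//.
    by rewrite invr_ge0 exprn_ge0// addr_ge0// ltW.
  rewrite lef_pV2 ?posrE ?exprn_gt0 ?ltr_wpDr//.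
  by apply: lerXn2r; rewrite ?nnegrE ?(ltW r0) ?(addr_ge0 (ltW x0))// ler_wpDr.
apply: ler_wpM2l; first by rewrite invr_ge0 exprn_ge0// ltW.
apply: (le_trans (shifted_power_sum2_le n x0)).
rewrite lerD// lef_pV2 ?posrE ?exprn_gt0//.
by apply: lerXn2r; rewrite ?nnegrE ?(ltW r0) ?(ltW x0).
Qed.

Lemma is_derive_gauss_approx (f : R -> R) n x : 0 < x ->
  is_derive x 1 (gauss_approx f n) (ln n.+2%:R - shifted_power_sum 1 n.+2 x).
Proof.
move=> x0.
have S : is_derive x 1 (fun y => \sum_(k < n.+2) ln (y + k%:R))
    (shifted_power_sum 1 n.+2 x).
  apply: (@is_derive_sumf _ n.+2 (fun k y => ln (y + k%:R))
    (fun k y => ((y + k%:R) ^+ 1)^-1)) => k; rewrite expr1.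
  by apply: is_derive_shiftf; apply: is_derive1_ln; rewrite ltr_wpDr.
have D := is_derive_addf (is_derive_constf (f n.+2%:R) x)
  (is_derive_mulf (is_derive_idf x) (is_derive_constf (ln n.+2%:R) x)).
by apply: is_derive_eq (is_derive_subf D S) _; rewrite mulr0 !add0r mulr1.
Qed.

Let pos_derive1 n x : 0 < x -> is_derive x 1
  (fun y => ln n.+2%:R - shifted_power_sum 1 n.+2 y) (shifted_power_sum 2 n.+2 x).
Proof.
move=> x0; have := is_derive_shifted_power_sum 1 n.+2 x0.
by move=> /(is_derive_subf (is_derive_constf (ln n.+2%:R) x)); rewrite sub0r opprK mul1r.
Qed.

Lemma lnGamma_derive x : 0 < x -> is_derive x 1 lnGamma (derive1 lnGamma x) /\
  (ln n.+2%:R - shifted_power_sum 1 n.+2 x @[n --> \oo] --> derive1 lnGamma x).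
Proof.
move: x; apply: (@derivative_of_limit R (gauss_approx lnGamma)
  (fun n y => ln n.+2%:R - shifted_power_sum 1 n.+2 y)
  (fun n => shifted_power_sum 2 n.+2)).
- exact: is_derive_gauss_approx.
- exact: pos_derive1.
- move=> r r0; have [M HM] := shifted_power_sum_bounded 0 r0.
  by exists M => n x; exact: HM.
- move=> x x0; apply: (@cvg_harmonic_bound _ _ _ (x + x ^+ 2)) => n.
  exact: (gauss_approx_error lnGammaS (@lnGamma_convex R)).
Qed.

(** Gamma inherits its differentiability from its logarithm. *)
Lemma derive1_lnGamma x : 0 < x -> derive1 lnGamma x = digamma x.
Proof.
move=> x0; rewrite /digamma; have [D _] := lnGamma_derive x0.
have DG : is_derive x 1 Gamma (Gamma x * derive1 lnGamma x).
  apply: (@near_eq_is_derive _ _ _ (expR \o lnGamma)).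
    near=> y; rewrite /= /lnGamma lnK// posrE Gamma_gt0//.
    by near: y; exact: lt_nbhsr.
  have := is_derive1_comp (is_derive_expR (lnGamma x)) D.
  by rewrite /lnGamma lnK ?posrE ?Gamma_gt0.
rewrite [in RHS]derive1E; have -> := @derive_val _ _ _ _ _ _ _ DG.
by rewrite mulrC mulKf ?gt_eqF ?Gamma_gt0.
Unshelve. all: by end_near. Qed.

Lemma is_derive_lnGamma x : 0 < x -> is_derive x 1 lnGamma (digamma x).
Proof.
move=> x0; have [D _] := lnGamma_derive x0.
exact: is_derive_eq D (derive1_lnGamma x0).
Qed.

Definition tetragamma : R -> R := derive1 trigamma.

Lemma digamma_derive x : 0 < x -> is_derive x 1 digamma (trigamma x) /\
  (shifted_power_sum 2 n.+2 x @[n --> \oo] --> trigamma x).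
Proof.
move: x; apply: (@derivative_of_limit R
  (fun n y => ln n.+2%:R - shifted_power_sum 1 n.+2 y)
  (fun n => shifted_power_sum 2 n.+2)
  (fun n y => - (2 * shifted_power_sum 3 n.+2 y))).
- exact: pos_derive1.
- by move=> n x; exact: is_derive_shifted_power_sum.
- move=> r r0; have [M HM] := shifted_power_sum_bounded 1 r0.
  exists (2 * M) => n x rx; rewrite normrN normrM ger0_norm//.
  by rewrite ler_pM2l// HM.
- by move=> x x0; have [_] := lnGamma_derive x0; rewrite (derive1_lnGamma x0).
Qed.

Lemma trigamma_derive x : 0 < x -> is_derive x 1 trigamma (tetragamma x) /\
  (- (2 * shifted_power_sum 3 n.+2 x) @[n --> \oo] --> tetragamma x).
Proof.
move: x; apply: (@derivative_of_limit R
  (fun n => shifted_power_sum 2 n.+2)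
  (fun n y => - (2 * shifted_power_sum 3 n.+2 y))
  (fun n y => 6 * shifted_power_sum 4 n.+2 y)).
- by move=> n x; exact: is_derive_shifted_power_sum.
- move=> n x x0; have D := is_derive_shifted_power_sum 3 n.+2 x0.
  by apply: is_derive_eq (is_derive_oppf (is_derive_scalef 2 D)) _; ring.
- move=> r r0; have [M HM] := shifted_power_sum_bounded 2 r0.
  exists (6 * M) => n x rx; rewrite normrM ger0_norm//.
  by rewrite ler_pM2l// HM.
- by move=> x x0; have [] := digamma_derive x0.
Qed.

Lemma is_derive_digamma x : 0 < x -> is_derive x 1 digamma (trigamma x).
Proof. by case/digamma_derive. Qed.

Lemma is_derive_trigamma x : 0 < x -> is_derive x 1 trigamma (tetragamma x).
Proof. by case/trigamma_derive. Qed.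

End BohrMollerup.

(** * Trigamma and tetragamma bounds by telescoping *)

Section Telescoping.
Context {R : realType}.
Implicit Types (x y r : R) (f g T U : R -> R) (n : nat).

(** f y exceeds f (y + 1), which dominates the limit 0 of f along y + n. *)
Lemma telescoping_gt0 f r :
  (forall y, r < y -> f (y + 1) < f y) ->
  (forall y, r < y -> f (y + n.+2%:R) @[n --> \oo] --> (0 : R)) ->
  forall y, r < y -> 0 < f y.
Proof.
move=> fdec flim y ry; apply: le_lt_trans (fdec y ry).
have ry1 : r < y + 1 by rewrite ltr_wpDr.
have le_f n : f (y + 1 + n%:R) <= f (y + 1).
  elim: n => [|n]; first by rewrite addr0.
  apply: le_trans; rewrite -natr1 addrA; apply/ltW/fdec.
  by rewrite ltr_wpDr.
rewrite -(cvg_lim _ (flim _ ry1))//; apply: limr_le.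
  by apply/cvg_ex; exists 0; exact: flim.
by apply: nearW => n; exact: le_f.
Qed.

Lemma cvg_inv_shift y c : 0 < y -> 0 <= c ->
  c / (y + n.+2%:R) @[n --> \oo] --> (0 : R).
Proof.
move=> y0 c0; apply: (@cvg_harmonic_bound _ _ _ c) => n.
have n1 : 0 < n.+1%:R :> R by [].
have yn : 0 < y + n.+2%:R by rewrite addr_gt0.
rewrite subr0 ger0_norm ?divr_ge0 ?(ltW yn)// ler_wpM2l// lef_pV2 ?posrE//.
by rewrite ler_wpDl ?(ltW y0)// ler_nat.
Qed.

(** The functional equations of trigamma and tetragamma and their decay along
    integer translations suffice for the bounds below.  Except for the last one,
    the difference f y - f (y + 1) to be telescoped is an explicit positive
    rational function. *)
Section TrigammaBounds.
Variables T U : R -> R.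
Hypothesis TS : forall y, 0 < y -> T (y + 1) = T y - (y ^+ 2)^-1.
Hypothesis US : forall y, 0 < y -> U (y + 1) = U y + 2 * (y ^+ 3)^-1.
Hypothesis Tlim : forall y, 0 < y -> T (y + n.+2%:R) @[n --> \oo] --> (0 : R).
Hypothesis Ulim : forall y, 0 < y -> U (y + n.+2%:R) @[n --> \oo] --> (0 : R).

Lemma trigamma_like_gt y : 0 < y -> y^-1 + (2 * y ^+ 2)^-1 < T y.
Proof.
move=> y0; rewrite -subr_gt0.
apply: (@telescoping_gt0 (fun z => T z - (z^-1 + (2 * z ^+ 2)^-1)) 0) y0.
- move=> z z0; rewrite TS// -subr_gt0.
  have -> : T z - (z^-1 + (2 * z ^+ 2)^-1) - (T z - (z ^+ 2)^-1 -
     ((z + 1)^-1 + (2 * (z + 1) ^+ 2)^-1)) = (2 * (z * (z + 1)) ^+ 2)^-1.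
    by field; rewrite !gt_eqF// addr_gt0.
  by rewrite invr_gt0 mulr_gt0// exprn_gt0// mulr_gt0// addr_gt0.
- move=> z z0; rewrite -(subr0 (0 : R)); apply: cvgB; first exact: Tlim.
  apply: (@cvg_harmonic_bound _ _ _ 2) => n.
  have n1 : 0 < n.+1%:R :> R by [].
  have zn : n.+1%:R <= z + n.+2%:R :> R by rewrite ler_wpDl ?ltW// ltr_nat.
  have zn1 : 1 <= z + n.+2%:R by apply: le_trans zn; rewrite ler1n.
  have zn0 : 0 < z + n.+2%:R by exact: lt_le_trans zn1.
  rewrite subr0 ger0_norm ?addr_ge0 ?invr_ge0 ?mulr_ge0 ?exprn_ge0 ?(ltW zn0)//.
  apply: (@le_trans _ _ (2 * (z + n.+2%:R)^-1)); last by rewrite ler_pM2l// lef_pV2.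
  move: zn1 zn0; move: (z + _) => v v1 v0.
  have : (2 * v ^+ 2)^-1 <= v^-1.
    by rewrite lef_pV2 ?posrE ?mulr_gt0 ?exprn_gt0//; nra.
  by move: (2 * v ^+ 2)^-1 v^-1 => p q; lra.
Qed.

Lemma trigamma_like_lt y : 2^-1 < y -> T y < (y - 2^-1)^-1.
Proof.
move=> y0; rewrite -subr_gt0.
apply: (@telescoping_gt0 (fun z => (z - 2^-1)^-1 - T z) 2^-1) y0.
- move=> z zh; have z0 : 0 < z by apply: lt_trans zh.
  have zh0 : 0 < z - 2^-1 by rewrite subr_gt0.
  rewrite TS// -subr_gt0.
  have -> : (z - 2^-1)^-1 - T z - ((z + 1 - 2^-1)^-1 - (T z - (z ^+ 2)^-1)) =
     (4 * (z - 2^-1) * (z + 2^-1) * z ^+ 2)^-1.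
    by field; rewrite !gt_eqF//; lra.
  by rewrite invr_gt0 !mulr_gt0 ?exprn_gt0// addr_gt0.
- move=> z zh; have z0 : 0 < z by apply: lt_trans zh.
  rewrite -(subr0 (0 : R)); apply: cvgB; last exact: Tlim.
  have := @cvg_inv_shift (z - 2^-1) 1; rewrite subr_gt0 => /(_ zh ler01).
  by under eq_cvg do rewrite mul1r addrAC.
Qed.

Lemma tetragamma_like_gt y : 1 < y -> - U y < ((y - 1) ^+ 2)^-1.
Proof.
move=> y1; rewrite -subr_gt0.
apply: (@telescoping_gt0 (fun z => ((z - 1) ^+ 2)^-1 - - U z) 1) y1.
- move=> z z1; have z0 : 0 < z by apply: lt_trans z1.
  have zh0 : 0 < z - 1 by rewrite subr_gt0.
  rewrite US// -subr_gt0.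
  have -> : ((z - 1) ^+ 2)^-1 - - U z - (((z + 1 - 1) ^+ 2)^-1 -
     - (U z + 2 * (z ^+ 3)^-1)) = (3 * z - 2) / (z ^+ 3 * (z - 1) ^+ 2).
    by field; rewrite !gt_eqF//; lra.
  by rewrite divr_gt0 ?mulr_gt0 ?exprn_gt0//; lra.
- move=> z z1; have z0 : 0 < z by apply: lt_trans z1.
  rewrite -(subr0 (0 : R)) -[X in _ --> _ - X](oppr0); apply: cvgB; last first.
    by apply: cvgN; exact: Ulim.
  apply: (@cvg_harmonic_bound _ _ _ 1) => n.
  have n1 : 1 <= n.+1%:R :> R by rewrite ler1n.
  have zn : n.+1%:R <= z + n.+2%:R - 1 :> R.
    by rewrite -[n.+2%:R]natr1 addrA addrK ler_wpDl// ltW.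
  have zn1 : 1 <= z + n.+2%:R - 1 by exact: le_trans zn.
  rewrite subr0 ger0_norm ?invr_ge0 ?exprn_ge0 ?(le_trans ler01)// mul1r.
  rewrite lef_pV2 ?posrE ?exprn_gt0 ?(lt_le_trans ltr01)//.
  apply: (le_trans zn); rewrite expr2 ler_peMr// (le_trans ler01)//.
Qed.

Lemma tetragamma_like_lt y : 0 < y -> (y + 1) / y ^+ 3 < - U y.
Proof.
move=> y0; rewrite -subr_gt0.
apply: (@telescoping_gt0 (fun z => - U z - (z + 1) / z ^+ 3) 0) y0.
- move=> z z0; have z1 : 0 < z + 1 by rewrite addr_gt0.
  rewrite US// -subr_gt0.
  have -> : - U z - (z + 1) / z ^+ 3 - (- (U z + 2 * (z ^+ 3)^-1) -
     (z + 1 + 1) / (z + 1) ^+ 3) = (2 * z + 1) / (z ^+ 3 * (z + 1) ^+ 3).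
    by field; rewrite !gt_eqF.
  by rewrite divr_gt0 ?mulr_gt0 ?exprn_gt0//; lra.
- move=> z z0.
  rewrite -(subr0 (0 : R)) -[X in _ --> X - _](oppr0); apply: cvgB.
    by apply: cvgN; exact: Ulim.
  apply: (@cvg_harmonic_bound _ _ _ 2) => n.
  have n1 : 0 < n.+1%:R :> R by [].
  have zn : n.+1%:R <= z + n.+2%:R :> R by rewrite ler_wpDl ?ltW// ltr_nat.
  have zn1 : 1 <= z + n.+2%:R by apply: le_trans zn; rewrite ler1n.
  have zn0 : 0 < z + n.+2%:R by exact: lt_le_trans zn1.
  have v0 : 0 <= (z + n.+2%:R + 1) / (z + n.+2%:R) ^+ 3.
    by rewrite divr_ge0 ?exprn_ge0 ?(ltW zn0)// addr_ge0 ?(ltW zn0).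
  rewrite subr0 ger0_norm// {v0}.
  apply: (@le_trans _ _ (2 * (z + n.+2%:R)^-1)); last by rewrite ler_pM2l// lef_pV2.
  move: zn1 zn0; move: (z + _) => v v1 v0.
  rewrite ler_pdivrMr ?exprn_gt0// exprS mulrA divfK ?gt_eqF//.
  nra.
Qed.

Lemma tetragamma_like_lt0 y : 0 < y -> U y < 0.
Proof.
move=> y0; rewrite -oppr_gt0; apply: lt_trans (tetragamma_like_lt y0).
by rewrite divr_gt0 ?exprn_gt0 ?addr_gt0.
Qed.

(** The derivative of (y - 1/2) T y.  Here f y - f (y + 1) still contains U, and
    its positivity is the lower bound on - U just obtained: two telescopings are
    nested. *)
Lemma shifted_trigamma_like_slope_gt0 y : 0 < y -> 0 < T y + (y - 2^-1) * U y.
Proof.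
apply: (@telescoping_gt0 (fun z => T z + (z - 2^-1) * U z)).
- move=> z z0; rewrite TS// US// -subr_gt0.
  have -> : T z + (z - 2^-1) * U z - (T z - (z ^+ 2)^-1 +
     (z + 1 - 2^-1) * (U z + 2 * (z ^+ 3)^-1)) = - U z - (z + 1) / z ^+ 3.
    by field; rewrite gt_eqF.
  by rewrite subr_gt0 tetragamma_like_lt.
- move=> z z0; rewrite -(addr0 (0 : R)); apply: cvgD; first exact: Tlim.
  apply: (@cvg_harmonic_bound _ _ _ 2) => n.
  have n1 : 1 <= n.+1%:R :> R by rewrite ler1n.
  have n0 : 0 < n.+1%:R :> R by [].
  have zn : n.+1%:R <= z + n.+2%:R - 1 :> R.
    by rewrite -[n.+2%:R]natr1 addrA addrK ler_wpDl// ltW.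
  move: (z + n.+2%:R) zn => v vn.
  have v1 : 0 < v - 1 by exact: lt_le_trans vn.
  have v0 : 0 < v by lra.
  have Uv : - U v <= ((v - 1) ^+ 2)^-1 by apply/ltW/tetragamma_like_gt; lra.
  have U0 : U v < 0 by exact: tetragamma_like_lt0.
  rewrite subr0 normrM (ltr0_norm U0) (@gtr0_norm _ (v - 2^-1)); last by lra.
  apply: (@le_trans _ _ (2 * (v - 1)^-1)); last by rewrite ler_pM2l// lef_pV2.
  apply: (@le_trans _ _ ((v - 2^-1) * ((v - 1) ^+ 2)^-1)).
    by rewrite ler_wpM2l//; lra.
  rewrite ler_pdivrMr ?exprn_gt0// expr2 mulrA divfK ?gt_eqF//.
  by lra.
Qed.

End TrigammaBounds.
End Telescoping.

(** * The facts about the polygamma functions that determine the shape *)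

Section PolygammaFacts.
Context {R : realType}.
Implicit Types (x y : R) (F g dF dg : R -> R).

(** Functional equations may be differentiated. *)
Lemma derive_shift_eq F g dF dg :
  (forall y, 0 < y -> is_derive y 1 F (dF y)) ->
  (forall y, 0 < y -> is_derive y 1 g (dg y)) ->
  (forall y, 0 < y -> F (y + 1) = F y + g y) ->
  forall y, 0 < y -> dF (y + 1) = dF y + dg y.
Proof.
move=> hF hg FS y y0.
have D1 : is_derive y 1 (fun z => F (z + 1)) (dF (y + 1)).
  by apply: is_derive_shiftf; apply: hF; rewrite addr_gt0.
have D2 : is_derive y 1 (fun z => F (z + 1)) (dF y + dg y).
  apply: (@near_eq_is_derive _ _ _ (fun z => F z + g z)).
    near=> z; rewrite FS//; near: z; exact: lt_nbhsr.
  exact: is_derive_addf (hF y y0) (hg y y0).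
by rewrite -(@derive_val _ _ _ _ _ _ _ D1) (@derive_val _ _ _ _ _ _ _ D2).
Unshelve. all: by end_near. Qed.

Lemma digammaS y : 0 < y -> digamma (y + 1) = digamma y + y^-1.
Proof.
exact: (derive_shift_eq is_derive_lnGamma (@is_derive1_ln R) lnGammaS).
Qed.

Lemma trigammaS y : 0 < y -> trigamma (y + 1) = trigamma y - (y ^+ 2)^-1.
Proof.
have D (z : R) : 0 < z -> is_derive z 1 (fun u : R => u^-1) (- (z ^+ 2)^-1).
  move=> z0; have z0' : z != 0 by rewrite gt_eqF.
  by have := @is_derive_invf _ (fun u => u) z 1 z0' (is_derive_idf z); rewrite mul1r.
exact: (derive_shift_eq is_derive_digamma D digammaS).
Qed.

Lemma tetragammaS y : 0 < y -> tetragamma (y + 1) = tetragamma y + 2 * (y ^+ 3)^-1.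
Proof.
have D (z : R) : 0 < z -> is_derive z 1 (fun u : R => - (u ^+ 2)^-1) (2 * (z ^+ 3)^-1).
  move=> z0; have z0' : z != 0 by rewrite gt_eqF.
  by have := is_derive_oppf (is_derive_expVn 2 z0'); rewrite opprK.
exact: (derive_shift_eq is_derive_trigamma D trigammaS).
Qed.

Lemma trigamma_cvg0 y : 0 < y -> trigamma (y + n.+2%:R) @[n --> \oo] --> (0 : R).
Proof.
move=> y0; have [_ h] := digamma_derive y0.
rewrite -(subrr (trigamma y)).
under eq_cvg => n do rewrite (unroll_recurrence _ y0 trigammaS) sumrN.
by apply: cvgB => //; exact: cvg_cst.
Qed.

Lemma tetragamma_cvg0 y : 0 < y -> tetragamma (y + n.+2%:R) @[n --> \oo] --> (0 : R).
Proof.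
move=> y0; have [_ h] := trigamma_derive y0.
rewrite -(subrr (tetragamma y)).
have E n : tetragamma (y + n.+2%:R) =
    tetragamma y - - (2 * shifted_power_sum 3 n.+2 y).
  by rewrite (unroll_recurrence _ y0 tetragammaS) -mulr_sumr opprK.
under eq_cvg => n do rewrite E.
by apply: cvgB => //; exact: cvg_cst.
Qed.

Lemma lnGamma1 : lnGamma (1 : R) = 0.
Proof. by rewrite /lnGamma Gamma1 ln1. Qed.

Lemma lnGamma2 : lnGamma (2 : R) = 0.
Proof. by rewrite -[2]natr1 lnGammaS// lnGamma1 ln1 addr0. Qed.

End PolygammaFacts.

(** What the shape analysis uses about L = ln Gamma and its first three
    derivatives.  Keeping the four functions abstract also keeps conversion from
    unfolding Euler's integral. *)
Record log_gamma_like {R : realType} (L psi T U : R -> R) : Prop := LogGammaLike {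
  lgl_derive : forall y : R, 0 < y -> is_derive y 1 L (psi y);
  lgl_derive2 : forall y : R, 0 < y -> is_derive y 1 psi (T y);
  lgl_derive3 : forall y : R, 0 < y -> is_derive y 1 T (U y);
  lgl_1 : L 1 = 0;
  lgl_2 : L 2 = 0;
  lgl_T_gt : forall y : R, 0 < y -> y^-1 + (2 * y ^+ 2)^-1 < T y;
  lgl_T_lt : forall y : R, 2^-1 < y -> T y < (y - 2^-1)^-1;
  lgl_U_lt0 : forall y : R, 0 < y -> U y < 0;
  lgl_U_gt : forall y : R, 1 < y -> - U y < ((y - 1) ^+ 2)^-1;
  lgl_slope : forall y : R, 0 < y -> 0 < T y + (y - 2^-1) * U y }.

Lemma lnGamma_like (R : realType) :
  log_gamma_like (@lnGamma R) digamma trigamma tetragamma.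
Proof.
have S2 := @trigammaS R; have S3 := @tetragammaS R.
have C2 := @trigamma_cvg0 R; have C3 := @tetragamma_cvg0 R.
split.
- exact: is_derive_lnGamma.
- exact: is_derive_digamma.
- exact: is_derive_trigamma.
- exact: lnGamma1.
- exact: lnGamma2.
- exact: trigamma_like_gt S2 C2.
- exact: trigamma_like_lt S2 C2.
- exact: tetragamma_like_lt0 S3 C3.
- exact: tetragamma_like_gt S3 C3.
- exact: shifted_trigamma_like_slope_gt0 S2 S3 C2 C3.
Qed.

(** * Monotonicity and convexity of exp (L(x + a) / x - c ln x) *)

Section MeanValueConsequences.
Context {R : realType}.
Implicit Types (f df d2f : R -> R) (x y : R).

Lemma derive_gt0_lt f df x y : x < y ->
  (forall z, x <= z <= y -> is_derive z 1 f (df z)) ->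
  (forall z, x < z < y -> 0 < df z) -> f x < f y.
Proof.
move=> xy D pos; have [c cxy e] := mean_value xy D.
by rewrite -subr_gt0 e mulr_gt0 ?subr_gt0// pos.
Qed.

Lemma derive_lt0_gt f df x y : x < y ->
  (forall z, x <= z <= y -> is_derive z 1 f (df z)) ->
  (forall z, x < z < y -> df z < 0) -> f y < f x.
Proof.
move=> xy D neg; have [c cxy e] := mean_value xy D.
by rewrite -subr_lt0 e pmulr_llt0 ?subr_gt0// neg.
Qed.

Lemma derive_ge0_le f df x y : x <= y ->
  (forall z, x <= z <= y -> is_derive z 1 f (df z)) ->
  (forall z, x < z < y -> 0 <= df z) -> f x <= f y.
Proof.
rewrite le_eqVlt => /predU1P[->//|xy] D pos; have [c cxy e] := mean_value xy D.
by rewrite -subr_ge0 e mulr_ge0 ?subr_ge0 ?(ltW xy)// pos.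
Qed.

(** The mean slope over the left half of [x, y] is smaller than the one over the
    right half. *)
Lemma derive2_gt0_midpoint f df d2f x y : x < y ->
  (forall z, x <= z <= y -> is_derive z 1 f (df z)) ->
  (forall z, x <= z <= y -> is_derive z 1 df (d2f z)) ->
  (forall z, x <= z <= y -> 0 < d2f z) ->
  f ((x + y) / 2) < (f x + f y) / 2.
Proof.
move=> xy D D2 pos; set m := (x + y) / 2.
have xm : x < m by rewrite /m; lra.
have my : m < y by rewrite /m; lra.
have [z /andP[xz zm]|c1 /andP[xc1 c1m] e1] := @mean_value _ f df x m xm.
  by apply: D; rewrite xz (le_trans zm)// ltW.
have [z /andP[mz zy]|c2 /andP[mc2 c2y] e2] := @mean_value _ f df m y my.
  by apply: D; rewrite zy (le_trans _ mz)// ltW.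
have c12 : c1 < c2 by exact: lt_trans mc2.
have df12 : df c1 < df c2.
  apply: (@derive_gt0_lt df d2f) => // z /andP[zl zr].
    by apply: D2; rewrite (le_trans (ltW xc1))//= (le_trans zr)// ltW.
  by apply: pos; rewrite (ltW (lt_trans xc1 zl)) (ltW (lt_trans zr c2y)).
have m1 : m - x = (y - x) / 2 by rewrite /m; field.
have m2 : y - m = (y - x) / 2 by rewrite /m; field.
rewrite {}m1 in e1; rewrite {}m2 in e2.
have : 0 < (df c2 - df c1) * ((y - x) / 2).
  by rewrite mulr_gt0 ?subr_gt0// divr_gt0// subr_gt0.
rewrite mulrBl -e1 -e2; lra.
Qed.

End MeanValueConsequences.

Section Shape.
Context {R : realType}.
Variables L psi T U : R -> R.
Hypothesis H : log_gamma_like L psi T U.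
Variable a : R.
Hypothesis a0 : 0 < a.
Implicit Types (x y z c : R).

Definition weighted_T x : R := x * T (x + a).
(** For a = 0 this is the value at psi x of the Legendre transform of L. *)
Definition legendre x : R := x * psi (x + a) - L (x + a).
(** Its sign decides the geometric convexity of exp (L (x + a) / x - c ln x). *)
Definition geo_discr x : R := x * weighted_T x - legendre x.
(** Its sign decides the logarithmic convexity of exp (L (x + a) / x - c ln x). *)
Definition log_discr c x : R := x * weighted_T x - 2 * legendre x + c * x.
Definition log_g c x : R := L (x + a) / x - c * ln x.

Local Notation w := weighted_T.
Local Notation G := legendre.
Local Notation p := geo_discr.
Local Notation u := log_discr.
Local Notation F := log_g.

Let xa_gt0 x : 0 <= x -> 0 < x + a.
Proof. by move=> x0; rewrite ltr_wpDl. Qed.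

Lemma is_derive_legendre x : 0 <= x -> is_derive x 1 G (w x).
Proof.
move=> x0; have D1 := is_derive_shiftf (lgl_derive H (xa_gt0 x0)).
have D2 := is_derive_shiftf (lgl_derive2 H (xa_gt0 x0)).
apply: is_derive_eq (is_derive_subf (is_derive_mulf (is_derive_idf x) D2) D1) _.
by rewrite /weighted_T; ring.
Qed.

Lemma is_derive_weighted_T x : 0 <= x ->
  is_derive x 1 w (T (x + a) + x * U (x + a)).
Proof.
move=> x0; have D := is_derive_shiftf (lgl_derive3 H (xa_gt0 x0)).
by apply: is_derive_eq (is_derive_mulf (is_derive_idf x) D) _; ring.
Qed.

Lemma is_derive_geo_discr x : 0 <= x ->
  is_derive x 1 p (x * (T (x + a) + x * U (x + a))).
Proof.
move=> x0; have D1 := is_derive_legendre x0; have D2 := is_derive_weighted_T x0.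
apply: is_derive_eq (is_derive_subf (is_derive_mulf (is_derive_idf x) D2) D1) _.
by ring.
Qed.

Lemma is_derive_log_discr c x : 0 <= x ->
  is_derive x 1 (u c) (x ^+ 2 * U (x + a) + c).
Proof.
move=> x0; have D1 := is_derive_legendre x0; have D2 := is_derive_weighted_T x0.
have D3 := is_derive_subf (is_derive_mulf (is_derive_idf x) D2)
  (is_derive_scalef 2 D1).
have D := is_derive_addf D3 (is_derive_scalef c (is_derive_idf x)).
by apply: is_derive_eq D _; rewrite /weighted_T; ring.
Qed.

Lemma is_derive_log_g c x : 0 < x ->
  is_derive x 1 (F c) ((G x - c * x) / x ^+ 2).
Proof.
move=> x0; have D1 := is_derive_shiftf (lgl_derive H (xa_gt0 (ltW x0))).
have xN0 : x != 0 by rewrite gt_eqF.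
have D2 := @is_derive_invf _ (fun y => y) x 1 xN0 (is_derive_idf x).
have D := is_derive_subf (is_derive_mulf D1 D2) (is_derive_scalef c (is_derive1_ln x0)).
by apply: is_derive_eq D _; rewrite /legendre; field.
Qed.

Lemma is_derive_log_g_slope c x : 0 < x ->
  is_derive x 1 (fun y => (G y - c * y) / y ^+ 2) (u c x / x ^+ 3).
Proof.
move=> x0; have xN0 : x != 0 by rewrite gt_eqF.
have D1 := is_derive_subf (is_derive_legendre (ltW x0))
  (is_derive_scalef c (is_derive_idf x)).
have D := is_derive_mulf D1 (is_derive_expVn 2 xN0).
by apply: is_derive_eq D _; rewrite /log_discr; field.
Qed.

Lemma is_derive_legendre_ratio x : 0 < x ->
  is_derive x 1 (fun y => G y / y) (p x / x ^+ 2).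
Proof.
move=> x0; have xN0 : x != 0 by rewrite gt_eqF.
have D2 := @is_derive_invf _ (fun y => y) x 1 xN0 (is_derive_idf x).
apply: is_derive_eq (is_derive_mulf (is_derive_legendre (ltW x0)) D2) _.
by rewrite /geo_discr; field.
Qed.

Lemma legendre0 : G 0 = - L a.
Proof. by rewrite /legendre mul0r !add0r. Qed.

Lemma geo_discr0 : p 0 = L a.
Proof. by rewrite /geo_discr mul0r sub0r legendre0 opprK. Qed.

Lemma log_discr0 c : u c 0 = 2 * L a.
Proof. by rewrite /log_discr mul0r mulr0 sub0r addr0 legendre0 mulrN opprK. Qed.

Lemma T_gt0 x : 0 < x -> 0 < T x.
Proof.
move=> x0; apply: lt_trans (lgl_T_gt H x0).
by rewrite addr_gt0 ?invr_gt0 ?mulr_gt0 ?exprn_gt0.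
Qed.

Lemma psi_incr x y : 0 < x -> x < y -> psi x < psi y.
Proof.
move=> x0 xy; apply: (derive_gt0_lt xy) => z /andP[xz _].
  by apply: (lgl_derive2 H); exact: lt_le_trans xz.
by apply: T_gt0; exact: lt_trans xz.
Qed.

Let L_mean x y : 0 < x -> x < y ->
  exists2 c, x < c < y & L y - L x = psi c * (y - x).
Proof.
move=> x0 xy; apply: mean_value xy _ => z /andP[xz _].
by apply: (lgl_derive H); exact: lt_le_trans xz.
Qed.

(** psi is increasing and vanishes somewhere between the zeros 1 and 2 of L. *)
Lemma L_gt0 x : 0 < x -> x < 1 \/ 2 < x -> 0 < L x.
Proof.
move=> x0 hx.
have [t /andP[t1 t2] e] := @L_mean 1 2 ltr01 (ltr1n _ 2).
rewrite (lgl_1 H) (lgl_2 H) subrr in e.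
have psit : psi t = 0 by move: e; lra.
case: hx => hx.
- have [s /andP[s1 s2]] := L_mean x0 hx; rewrite (lgl_1 H) sub0r => e'.
  have : psi s < 0 by rewrite -psit psi_incr ?(lt_trans s2)// (lt_trans x0).
  by move=> ps; rewrite -oppr_lt0 e' nmulr_rlt0// subr_gt0.
- have [s /andP[s1 s2]] := @L_mean 2 x (ltr0n _ 2) hx; rewrite (lgl_2 H) subr0 => ->.
  have : 0 < psi s by rewrite -psit psi_incr ?(lt_trans t2)// (lt_trans ltr01).
  by move=> ps; rewrite mulr_gt0// subr_gt0.
Qed.

Lemma L_lt0 x : 1 < x -> x < 2 -> L x < 0.
Proof.
move=> x1 x2; have x0 : 0 < x by exact: lt_trans x1.
have [s /andP[s1 s2]] := L_mean ltr01 x1; rewrite (lgl_1 H) subr0 => e1.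
have [t /andP[t1 t2]] := L_mean x0 x2; rewrite (lgl_2 H) sub0r => e2.
have st : psi s < psi t by apply: psi_incr; [apply: lt_trans s1|apply: lt_trans t1].
rewrite ltNge; apply/negP => L0.
have : 0 <= psi s by rewrite -(@pmulr_lge0 _ (x - 1)) ?subr_gt0// -e1.
have : psi t <= 0 by rewrite -(@pmulr_lle0 _ (2 - x)) ?subr_gt0// -e2 oppr_le0.
by lra.
Qed.

(** With z = (z + a - 1/2) - (a - 1/2) and U < 0, the derivative
    T + z U at z + a is at least the slope of (y - 1/2) T y, which is positive. *)
Lemma geo_discr_incr x y : 2^-1 <= a -> 0 <= x -> x < y -> p x < p y.
Proof.
move=> a2 x0 xy; apply: (derive_gt0_lt xy) => z /andP[xz _].
  by apply: is_derive_geo_discr; exact: le_trans xz.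
have z0 : 0 < z by exact: le_lt_trans xz.
have za := xa_gt0 (ltW z0).
have := lgl_slope H za; have := lgl_U_lt0 H za.
rewrite pmulr_rgt0//; move: (T _) (U _) => t v v0.
have : 0 <= (2^-1 - a) * v by rewrite mulr_le0// ?subr_le0// ltW.
by lra.
Qed.

Definition geo_convex_range := 2^-1 <= a <= 1 \/ 2 <= a.

Lemma geo_convex_range_half : geo_convex_range -> 2^-1 <= a.
Proof. by move=> [/andP[]//|]; lra. Qed.

Lemma geo_convex_range_L : geo_convex_range -> 0 <= L a.
Proof.
move=> [/andP[_]|]; rewrite le_eqVlt => /predU1P[h|h].
- by rewrite h (lgl_1 H).
- by apply/ltW/L_gt0 => //; left.
- by rewrite -h (lgl_2 H).
- by apply/ltW/L_gt0 => //; right.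
Qed.

Lemma geo_discr_gt0 x : geo_convex_range -> 0 < x -> 0 < p x.
Proof.
move=> ha x0; apply: (@le_lt_trans _ _ (p 0)).
  by rewrite geo_discr0 geo_convex_range_L.
by apply: geo_discr_incr => //; exact: geo_convex_range_half.
Qed.

Lemma weighted_T_lt x : 0 < x -> 2^-1 < x + a -> w x < x / (x + a - 2^-1).
Proof. by move=> x0 xa; rewrite ltr_pM2l// (lgl_T_lt H). Qed.

Lemma weighted_T_lt1 x : 2^-1 <= a -> 0 < x -> w x < 1.
Proof.
move=> a2 x0; apply: lt_le_trans (weighted_T_lt x0 _) _; first by lra.
by rewrite ler_pdivrMr; lra.
Qed.

Lemma weighted_T_gt0 x : 0 < x -> 0 < w x.
Proof. by move=> x0; rewrite mulr_gt0// T_gt0// xa_gt0// ltW. Qed.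

(** p > 0 says G x < x w x, and w < 1. *)
Lemma legendre_lt x : geo_convex_range -> 0 < x -> G x < x.
Proof.
move=> ha x0; have := geo_discr_gt0 ha x0; rewrite subr_gt0 => /lt_trans; apply.
by rewrite gtr_pMr// weighted_T_lt1// geo_convex_range_half.
Qed.

Lemma legendre_eventually_gt c : c < 1 ->
  exists2 N, 0 < N & forall x, N <= x -> c * x < G x.
Proof.
(* From some N0 on, the slope w of G exceeds d, which lies between c and 1;
   the line of slope d then overtakes c x beyond N. *)
move=> c1; pose d := (1 + c) / 2.
have d1 : d < 1 by rewrite /d; lra.
have cd : c < d by rewrite /d; lra.
pose N0 := 1 + `|d * a / (1 - d)|.
have N00 : 0 < N0 by rewrite ltr_wpDr.
have wd x : N0 <= x -> d <= w x.
  move=> Nx; have x0 : 0 < x by exact: lt_le_trans Nx.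
  have xa := xa_gt0 (ltW x0).
  apply: (@le_trans _ _ (x / (x + a))).
    rewrite ler_pdivlMr//.
    have : d * a / (1 - d) <= x.
      apply: le_trans Nx; apply: (le_trans (ler_norm _)).
      by rewrite lerDr.
    by rewrite ler_pdivrMr ?subr_gt0//; lra.
  rewrite ler_pM2l//; apply: ltW; apply: lt_trans (lgl_T_gt H xa).
  by rewrite ltrDl invr_gt0 mulr_gt0// exprn_gt0.
pose N := N0 + `|(G N0 - d * N0) / (c - d)| + 1.
have NN0 : N0 <= N by rewrite /N -addrA lerDl addr_ge0.
exists N; first by exact: lt_le_trans NN0.
move=> x Nx; have N0x : N0 <= x by exact: le_trans Nx.
have : G N0 - d * N0 <= G x - d * x.
  apply: (@derive_ge0_le _ (fun z => G z - d * z) (fun z => w z - d * 1)) => // z.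
    move=> /andP[Nz _]; have z0 : 0 <= z by apply: le_trans Nz; exact: ltW.
    exact: is_derive_subf (is_derive_legendre z0) (is_derive_scalef d (is_derive_idf z)).
  by move=> /andP[Nz _]; rewrite mulr1 subr_ge0 wd// ltW.
have : (G N0 - d * N0) / (c - d) < x.
  apply: lt_le_trans Nx; apply: (le_lt_trans (ler_norm _)).
  by rewrite /N; lra.
by rewrite ltr_ndivrMr ?subr_lt0//; lra.
Qed.

Lemma legendre_gt0 x : L a = 0 -> 0 < x -> 0 < G x.
Proof.
move=> La x0; rewrite -[X in X < _](_ : G 0 = 0); last by rewrite legendre0 La oppr0.
apply: (derive_gt0_lt x0) => z /andP[z0 _]; first exact: is_derive_legendre.
exact: weighted_T_gt0.
Qed.

Lemma legendre_small c : 1 <= a -> L a = 0 -> 0 < c ->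
  exists2 d, 0 < d & forall x, 0 < x -> x <= d -> G x < c * x.
Proof.
(* G x = w s * x for some s < x, and w s <= 2 s because a >= 1. *)
move=> a1 La c0; exists (c / 2); first by rewrite divr_gt0.
move=> x x0 xd.
have [z /andP[z0 _]|s /andP[s0 sx]] := @mean_value _ G w 0 x x0.
  exact: is_derive_legendre.
rewrite legendre0 La !oppr0 !addr0 => ->; rewrite ltr_pM2r//.
apply: lt_le_trans (weighted_T_lt s0 _) _; first by lra.
rewrite ler_pdivrMr; last by lra.
have : s <= c * (s + a - 2^-1); last by [].
apply: (@le_trans _ _ (c * 2^-1)); last by rewrite ler_pM2l//; lra.
exact: le_trans (ltW sx) xd.
Qed.

Lemma log_discr_gt0 c x : 2 <= a -> 1 <= c -> 0 < x -> 0 < u c x.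
Proof.
move=> a2 c1 x0; apply: (@le_lt_trans _ _ (u c 0)).
  by rewrite log_discr0 mulr_ge0// geo_convex_range_L//; right.
apply: (derive_gt0_lt x0) => z /andP[z0 _]; first exact: is_derive_log_discr.
(* - U (z + a) < 1 / (z + a - 1)^2, and z + a - 1 >= z. *)
have za1 : 1 < z + a by lra.
have := lgl_U_gt H za1; rewrite -(@ltr_pM2l _ (z ^+ 2)) ?exprn_gt0//.
have : z ^+ 2 * ((z + a - 1) ^+ 2)^-1 <= 1.
  rewrite ler_pdivrMr ?exprn_gt0//; last by lra.
  by rewrite mul1r lerXn2r ?nnegrE//; lra.
by move: (_ * _^-1) => q; rewrite mulrN; lra.
Qed.

Lemma log_discr_lt0 c x : L a = 0 -> c <= 0 -> 0 < x -> u c x < 0.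
Proof.
move=> La c0 x0; rewrite -[X in _ < X](_ : u c 0 = 0); last by rewrite log_discr0 La mulr0.
apply: (derive_lt0_gt x0) => z /andP[z0 _]; first exact: is_derive_log_discr.
have : z ^+ 2 * U (z + a) < 0.
  by rewrite pmulr_rlt0 ?exprn_gt0// (lgl_U_lt0 H)// xa_gt0// ltW.
by lra.
Qed.

Lemma log_discr_eventually_lt0 c : 2^-1 <= a -> c < 1 ->
  exists2 N, 0 < N & forall x, N <= x -> u c x < 0.
Proof.
move=> a2 c1; have [|N N0 hN] := @legendre_eventually_gt ((1 + c) / 2); first by lra.
exists N => // x Nx; have x0 : 0 < x by exact: lt_le_trans Nx.
have := hN x Nx; have : x * w x < x by rewrite gtr_pMr// weighted_T_lt1.
rewrite /log_discr; lra.
Qed.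

Lemma log_discr_small c : 1 <= a -> L a = 0 -> 0 < c ->
  exists2 d, 0 < d & forall x, 0 < x -> x <= d -> 0 < u c x.
Proof.
move=> a1 La c0; have [|d d0 hd] := @legendre_small (c / 2) a1 La; first by rewrite divr_gt0.
exists d => // x x0 xd; have := hd x x0 xd.
have : 0 < x * w x by rewrite mulr_gt0// weighted_T_gt0.
rewrite /log_discr; lra.
Qed.

(** The lower bound on T integrates to G x >= x + b ln (x + a) + C with
    b = 1/2 - a > 0, while its upper bound gives x w x <= x + 1; hence
    p x <= 1 - C - b ln (x + a). *)
Lemma geo_discr_eventually_lt0 : a < 2^-1 ->
  exists2 N, 0 < N & forall x, N <= x -> p x < 0.
Proof.
have ha0 := a0; move=> a2; pose b := 2^-1 - a; have b0 : 0 < b by rewrite subr_gt0.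
pose phi x : R := G x - x - b * ln (x + a) - a / 2 * (x + a)^-1.
pose C := phi 1; pose N := 1 + expR ((1 - C) / b).
have N1 : (1 : R) <= N by rewrite lerDl expR_ge0.
have N0 : 0 < N by exact: lt_le_trans N1.
exists N => // x Nx; have x1 : (1 : R) <= x by exact: le_trans Nx.
have x0 : 0 < x by exact: lt_le_trans x1.
have lnN : (1 - C) / b <= ln (x + a).
  rewrite -(expRK ((1 - C) / b)) ler_ln ?posrE ?expR_gt0 ?(xa_gt0 (ltW x0))//.
  by apply: (le_trans _ (le_trans Nx _)); [rewrite lerDr|rewrite lerDl ltW].
have phi_le : C <= phi x.
  pose dphi z : R := w z - 1 - b * (z + a)^-1 - a / 2 * - ((z + a) ^+ 2)^-1.
  apply: (@derive_ge0_le _ phi dphi 1 x x1) => z /andP[z1 _].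
    have z0 : 0 <= z by exact: le_trans z1.
    have za := xa_gt0 z0; have zaN0 : z + a != 0 by rewrite gt_eqF.
    have D1 := is_derive_shiftf (is_derive1_ln za).
    have DV := @is_derive_invf _ (fun y => y) (z + a) 1 zaN0 (is_derive_idf _).
    have D2 := is_derive_shiftf DV.
    have DG := is_derive_subf (is_derive_legendre z0) (is_derive_idf z).
    have D := is_derive_subf (is_derive_subf DG (is_derive_scalef b D1))
      (is_derive_scalef (a / 2) D2).
    by apply: is_derive_eq D _; rewrite /dphi mul1r.
  have z0 : 0 < z by apply: lt_trans z1.
  have za := xa_gt0 (ltW z0).
  have : z * ((z + a)^-1 + (2 * (z + a) ^+ 2)^-1) < w z by rewrite ltr_pM2l// (lgl_T_gt H).
  have -> : z * ((z + a)^-1 + (2 * (z + a) ^+ 2)^-1) =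
      1 + b * (z + a)^-1 + a / 2 * - ((z + a) ^+ 2)^-1.
    by rewrite /b; field; rewrite gt_eqF.
  by rewrite /dphi => h; apply: ltW; rewrite subr_gt0 ltrBrDr ltrBrDl; lra.
have inv0 : 0 <= a / 2 * (x + a)^-1.
  by rewrite mulr_ge0 ?invr_ge0 ?divr_ge0 ?ltW// xa_gt0// ltW.
have Gx : x + b * ln (x + a) + C <= G x by move: phi_le; rewrite /phi; lra.
have := ler_wpM2l (ltW b0) lnN.
rewrite mulrC divfK ?gt_eqF// => bln.
have xb : 0 < x + a - 2^-1 by lra.
have : x * w x < x * (x / (x + a - 2^-1)).
  by rewrite ltr_pM2l// weighted_T_lt//; lra.
have : x * (x / (x + a - 2^-1)) <= x + 1.
  rewrite mulrA ler_pdivrMr//.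
  have -> : x * x = (x + 1) * (x + a - 2^-1) - (x * (a + 2^-1) + (a - 2^-1)) by field.
  rewrite gerBl; have : 1 * (a + 2^-1) <= x * (a + 2^-1) by rewrite ler_pM2r//; lra.
  by lra.
by rewrite /geo_discr; lra.
Qed.

(** The mirror image of the previous estimate: with b = a - 1/2, the upper bound
    on T gives G x <= x - b ln (x + b) - C, and the lower one
    x w x >= x - b - a / 2. *)
Lemma geo_discr_eventually_gt0 : 2^-1 < a -> exists2 x, 0 < x & 0 < p x.
Proof.
have ha0 := a0; move=> a2; pose b := a - 2^-1; have b0 : 0 < b by rewrite subr_gt0.
pose phi x : R := x - G x - b * ln (x + b).
pose C := phi 1; pose x := 1 + expR ((b + a / 2 + 1 - C) / b).
have x1 : (1 : R) <= x by rewrite lerDl expR_ge0.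
have x0 : 0 < x by exact: lt_le_trans x1.
exists x => //.
have xb0 : 0 < x + b by exact: addr_gt0 x0 b0.
have lnx : (b + a / 2 + 1 - C) / b <= ln (x + b).
  rewrite -(expRK (_ / b)) ler_ln ?posrE ?expR_gt0 ?xb0//.
  by apply: (@le_trans _ _ x); [rewrite lerDr|rewrite lerDl ltW].
have phi_le : C <= phi x.
  apply: (@derive_ge0_le _ phi (fun z => 1 - w z - b * (z + b)^-1) 1 x x1) => z /andP[z1 _].
    have z0 : 0 <= z by exact: le_trans z1.
    have zb : 0 < z + b by rewrite ltr_wpDl.
    have D1 := is_derive_shiftf (is_derive1_ln zb).
    have DG := is_derive_subf (is_derive_idf z) (is_derive_legendre z0).
    exact: is_derive_subf DG (is_derive_scalef b D1).
  have z0 : 0 < z by apply: lt_trans z1.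
  have zb : 0 < z + b by rewrite addr_gt0.
  have : w z < z / (z + a - 2^-1) by apply: weighted_T_lt => //; rewrite /b in zb; lra.
  have -> : z / (z + a - 2^-1) = 1 - b * (z + b)^-1.
    by rewrite /b in zb *; field; rewrite gt_eqF//; lra.
  by lra.
have := ler_wpM2l (ltW b0) lnx.
rewrite mulrC divfK ?gt_eqF// => bln.
have xa : 0 < x + a by exact: addr_gt0 x0 a0.
have : x * (x * ((x + a)^-1 + (2 * (x + a) ^+ 2)^-1)) < x * w x.
  by rewrite !ltr_pM2l// (lgl_T_gt H).
have -> : x * (x * ((x + a)^-1 + (2 * (x + a) ^+ 2)^-1)) =
    x - b * (x / (x + a)) - a / 2 * (x / (x + a) ^+ 2).
  by rewrite /b; field; rewrite gt_eqF.
have : b * (x / (x + a)) <= b by rewrite ger_pMr// ler_pdivrMr// mul1r lerDl ltW.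
have : a / 2 * (x / (x + a) ^+ 2) <= a / 2.
  rewrite ger_pMr ?divr_gt0// ler_pdivrMr ?exprn_gt0// mul1r.
  by nra.
by move: phi_le; rewrite /phi /geo_discr; lra.
Qed.

Lemma geo_discr_continuous (I : set R) : I `<=` [set x | 0 <= x] ->
  {within I, continuous p}.
Proof.
move=> I0; apply: continuous_in_subspaceT => z /set_mem /I0 z0.
exact: is_derive_continuous (is_derive_geo_discr z0).
Qed.

Lemma geo_discr_root : 1 < a -> a < 2 ->
  exists x3, [/\ 0 < x3, p x3 = 0,
    forall x, 0 < x -> x < x3 -> p x < 0 & forall x, x3 < x -> 0 < p x].
Proof.
move=> a1 a2; have ah : 2^-1 < a by lra.
have [X X0 pX] := geo_discr_eventually_gt0 ah.
have p0 : p 0 < 0 by rewrite geo_discr0 L_lt0.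
have [|||x3] := @IVT R p 0 X 0.
- exact: ltW.
- by apply: geo_discr_continuous => x /=; rewrite in_itv/= => /andP[].
- by rewrite ge_min le_max (ltW p0) (ltW pX) orbT.
rewrite in_itv/= => /andP[x30 _] px3.
have {}x30 : 0 < x3.
  rewrite lt_neqAle x30 andbT; apply/eqP => e; rewrite -e in px3.
  by move: p0; rewrite px3 ltxx.
exists x3; split=> // x.
- by move=> x0 xx3; rewrite -px3; apply: geo_discr_incr => //; exact: ltW.
- by move=> x3x; rewrite -px3; apply: geo_discr_incr => //; exact: ltW.
Qed.

Variable g : R -> R -> R.
Hypothesis gE : forall c x, 0 < x -> g c x = expR (F c x).

Lemma sqrt_expR_mul (A B : R) :
  Num.sqrt (expR A * expR B) = expR ((A + B) / 2).
Proof.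
rewrite -expRD [in LHS](_ : A + B = 2%:R * ((A + B) / 2)); last by field.
by rewrite expRM_natl sqrtr_sqr ger0_norm ?expR_ge0.
Qed.

Lemma g_lt c x y : 0 < x -> x < y -> (forall z, x < z < y -> c * z < G z) ->
  g c x < g c y.
Proof.
move=> x0 xy h; have y0 : 0 < y by exact: lt_trans xy.
rewrite !gE// ltr_expR.
apply: (@derive_gt0_lt _ (F c) (fun z => (G z - c * z) / z ^+ 2) x y xy) => z /andP[xz zy].
  by apply: is_derive_log_g; exact: lt_le_trans xz.
have z0 : 0 < z by exact: lt_trans xz.
by apply: divr_gt0; rewrite ?exprn_gt0// subr_gt0 h// xz.
Qed.

Lemma g_gt c x y : 0 < x -> x < y -> (forall z, x < z < y -> G z < c * z) ->
  g c y < g c x.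
Proof.
move=> x0 xy h; have y0 : 0 < y by exact: lt_trans xy.
rewrite !gE// ltr_expR.
apply: (@derive_lt0_gt _ (F c) (fun z => (G z - c * z) / z ^+ 2) x y xy) => z /andP[xz zy].
  by apply: is_derive_log_g; exact: lt_le_trans xz.
have z0 : 0 < z by exact: lt_trans xz.
by rewrite pmulr_llt0 ?invr_gt0 ?exprn_gt0// subr_lt0 h// xz.
Qed.

Lemma g_log_convex_lt c x y : 0 < x -> x < y ->
  (forall z, x <= z <= y -> 0 < u c z) ->
  g c ((x + y) / 2) < Num.sqrt (g c x * g c y).
Proof.
move=> x0 xy h; have y0 : 0 < y by exact: lt_trans xy.
have m0 : 0 < (x + y) / 2 by rewrite divr_gt0 ?addr_gt0.
have pos z : x <= z <= y -> 0 < z by move=> /andP[+ _]; exact: lt_le_trans.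
rewrite !gE// sqrt_expR_mul ltr_expR.
apply: (@derive2_gt0_midpoint _ (F c) (fun z => (G z - c * z) / z ^+ 2)
  (fun z => u c z / z ^+ 3) x y xy) => z xzy.
- exact: is_derive_log_g (pos z xzy).
- exact: is_derive_log_g_slope (pos z xzy).
- by rewrite divr_gt0 ?h ?exprn_gt0 ?pos.
Qed.

Lemma g_log_concave_lt c x y : 0 < x -> x < y ->
  (forall z, x <= z <= y -> u c z < 0) ->
  Num.sqrt (g c x * g c y) < g c ((x + y) / 2).
Proof.
move=> x0 xy h; have y0 : 0 < y by exact: lt_trans xy.
have m0 : 0 < (x + y) / 2 by rewrite divr_gt0 ?addr_gt0.
have pos z : x <= z <= y -> 0 < z by move=> /andP[+ _]; exact: lt_le_trans.
rewrite !gE// sqrt_expR_mul ltr_expR -ltrN2.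
have -> : - ((F c x + F c y) / 2) = (- F c x - F c y) / 2 by ring.
apply: (@derive2_gt0_midpoint _ (fun z => - F c z) (fun z => - ((G z - c * z) / z ^+ 2))
  (fun z => - (u c z / z ^+ 3)) x y xy) => z xzy.
- exact: is_derive_oppf (is_derive_log_g c (pos z xzy)).
- exact: is_derive_oppf (is_derive_log_g_slope c (pos z xzy)).
- by rewrite oppr_gt0 pmulr_llt0 ?h// invr_gt0 exprn_gt0// pos.
Qed.

(** In the variable s = ln x the constant c only shifts the derivative, so it
    drops out of the second one. *)
Lemma is_derive_log_g_exp c (s : R) :
  is_derive s 1 (fun t : R => F c (expR t)) (G (expR s) / expR s - c).
Proof.
have e0 := expR_gt0 s; have D := is_derive_compf (is_derive_log_g c e0) (is_derive_expR s).
by apply: is_derive_eq D _; field; rewrite gt_eqF.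
Qed.

Lemma is_derive_log_g_exp_slope c (s : R) :
  is_derive s 1 (fun t : R => G (expR t) / expR t - c) (p (expR s) / expR s).
Proof.
have e0 := expR_gt0 s.
have D := is_derive_compf (is_derive_legendre_ratio e0) (is_derive_expR s).
by apply: is_derive_eq (is_derive_subf D (is_derive_constf c s)) _; field; rewrite gt_eqF.
Qed.

Let sqrt_exp_ln x y : 0 < x -> 0 < y ->
  Num.sqrt (x * y) = expR ((ln x + ln y) / 2).
Proof. by move=> x0 y0; rewrite -sqrt_expR_mul !lnK. Qed.

Let exp_between x y s : 0 < x -> 0 < y -> ln x <= s <= ln y -> x <= expR s <= y.
Proof.
by move=> x0 y0; rewrite -(ler_expR (ln x)) -(ler_expR s) !lnK.
Qed.

Lemma g_geo_convex_lt c x y : 0 < x -> x < y ->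
  (forall z, x <= z <= y -> 0 < p z) ->
  g c (Num.sqrt (x * y)) < Num.sqrt (g c x * g c y).
Proof.
move=> x0 xy h; have y0 : 0 < y by exact: lt_trans xy.
have m0 : 0 < Num.sqrt (x * y) by rewrite sqrtr_gt0 mulr_gt0.
rewrite !gE// sqrt_expR_mul ltr_expR sqrt_exp_ln//.
rewrite -{2}(lnK (x := x))// -{2}(lnK (x := y))//.
apply: (@derive2_gt0_midpoint _ (fun s => F c (expR s)) (fun s => G (expR s) / expR s - c)
  (fun s => p (expR s) / expR s)).
- by rewrite ltr_ln.
- by move=> s _; exact: is_derive_log_g_exp.
- by move=> s _; exact: is_derive_log_g_exp_slope.
- by move=> s /(exp_between x0 y0) hs; rewrite divr_gt0 ?expR_gt0 ?h.
Qed.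

Lemma g_geo_concave_lt c x y : 0 < x -> x < y ->
  (forall z, x <= z <= y -> p z < 0) ->
  Num.sqrt (g c x * g c y) < g c (Num.sqrt (x * y)).
Proof.
move=> x0 xy h; have y0 : 0 < y by exact: lt_trans xy.
have m0 : 0 < Num.sqrt (x * y) by rewrite sqrtr_gt0 mulr_gt0.
rewrite !gE// sqrt_expR_mul ltr_expR sqrt_exp_ln//.
rewrite -{1}(lnK (x := x))// -{1}(lnK (x := y))//.
rewrite -ltrN2 [X in _ < X](_ : _ =
  (- F c (expR (ln x)) - F c (expR (ln y))) / 2); last by ring.
apply: (@derive2_gt0_midpoint _ (fun s => - F c (expR s))
  (fun s => - (G (expR s) / expR s - c)) (fun s => - (p (expR s) / expR s))).
- by rewrite ltr_ln.
- by move=> s _; exact: is_derive_oppf (is_derive_log_g_exp c s).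
- by move=> s _; exact: is_derive_oppf (is_derive_log_g_exp_slope c s).
- move=> s /(exp_between x0 y0) hs.
  by rewrite oppr_gt0 pmulr_llt0 ?h// invr_gt0 expR_gt0.
Qed.

Lemma g_continuous_positive c (I : interval R) :
  {in I, forall x, 0 < x} -> continuous_positive I (g c).
Proof.
move=> I0; split; last by move=> x /I0 x0; rewrite gE// expR_gt0.
apply: continuous_in_subspaceT => x /set_mem /I0 x0.
have D := is_derive_compf (is_derive_expR (F c x)) (is_derive_log_g c x0).
apply: is_derive_continuous; apply: (near_eq_is_derive _ D).
near=> y; rewrite gE//; near: y; exact: lt_nbhsr.
Unshelve. all: by end_near. Qed.

Lemma geometrically_convexP c (I : interval R) :
  {in I, forall x, 0 < x} ->
  {in I &, forall x y z, x <= z <= y -> 0 < p z} ->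
  geometrically_convex I (g c).
Proof.
move=> I0 h; split=> //; first exact: g_continuous_positive.
move=> x y xI yI; have x0 := I0 _ xI; have y0 := I0 _ yI.
have [xy|yx|->] := ltgtP x y.
- by apply/ltW/g_geo_convex_lt => // z; exact: h.
- by rewrite (mulrC x) (mulrC (g c x)); apply/ltW/g_geo_convex_lt => // z; exact: h.
- by rewrite -!expr2 !sqrtr_sqr !ger0_norm ?gE ?expR_ge0// ltW.
Qed.

Lemma geometrically_concaveP c (I : interval R) :
  {in I, forall x, 0 < x} ->
  {in I &, forall x y z, x <= z <= y -> p z < 0} ->
  geometrically_concave I (g c).
Proof.
move=> I0 h; split=> //; first exact: g_continuous_positive.
move=> x y xI yI; have x0 := I0 _ xI; have y0 := I0 _ yI.
have [xy|yx|->] := ltgtP x y.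
- by apply/ltW/g_geo_concave_lt => // z; exact: h.
- by rewrite (mulrC x) (mulrC (g c x)); apply/ltW/g_geo_concave_lt => // z; exact: h.
- by rewrite -!expr2 !sqrtr_sqr !ger0_norm ?gE ?expR_ge0// ltW.
Qed.

Let pos_itv (x : R) : (x \in `]0, +oo[) = (0 < x).
Proof. by rewrite in_itv/= andbT. Qed.

Lemma not_geo_convex_range : ~ geo_convex_range -> a < 2^-1 \/ 1 < a < 2.
Proof.
move=> h; have [a2|a2] := ltP a 2^-1; first by left.
right; apply/andP; split; rewrite ltNge; apply/negP => k; apply: h.
  by left; rewrite a2 k.
by right.
Qed.

Lemma geo_convex_iff c : geometrically_convex `]0, +oo[ (g c) <-> geo_convex_range.
Proof.
split=> [[_ _ conv]|ha]; last first.
  apply: geometrically_convexP => [x|x y]; first by rewrite pos_itv.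
  rewrite !pos_itv => x0 y0 z /andP[xz _].
  by apply: geo_discr_gt0 => //; exact: lt_le_trans xz.
have absurd x y : 0 < x -> x < y -> ~ (forall z, x <= z <= y -> p z < 0).
  move=> x0 xy neg; have := g_geo_concave_lt c x0 xy neg.
  by rewrite ltNge conv// pos_itv// (lt_trans x0).
apply: contrapT => /not_geo_convex_range[a2|/andP[a1 a2]].
- have [N N0 hN] := geo_discr_eventually_lt0 a2.
  apply: (absurd N (N + 1)) => //; first by rewrite ltrDl.
  by move=> z /andP[Nz _]; exact: hN.
- have [x3 [x30 _ neg _]] := geo_discr_root a1 a2.
  apply: (absurd (x3 / 3) (x3 / 2)); [by rewrite divr_gt0|by lra|].
  by move=> z /andP[z1 z2]; apply: neg; lra.
Qed.

Lemma decreasing_iff c : geo_convex_range ->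
  strictly_decreasing `]0, +oo[ (g c) <-> 1 <= c.
Proof.
move=> ha; split=> [dec|c1].
- rewrite leNgt; apply/negP => c1.
  have [N N0 hN] := legendre_eventually_gt c1.
  have N1 : N < N + 1 by rewrite ltrDl.
  have N10 : 0 < N + 1 by exact: lt_trans N1.
  have := @g_lt c N (N + 1) N0 N1 _; rewrite ltNge => /(_ _)/negP; apply.
    by move=> z /andP[Nz _]; apply: hN; exact: ltW.
  by apply/ltW/dec; rewrite ?pos_itv.
- move=> x y; rewrite !pos_itv => x0 y0 yx; apply: g_gt => // z /andP[yz _].
  have z0 : 0 < z by exact: lt_trans yz.
  by apply: lt_le_trans (legendre_lt ha z0) _; rewrite ler_peMl// ltW.
Qed.

Lemma increasing_iff c : 1 <= a -> L a = 0 ->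
  strictly_increasing `]0, +oo[ (g c) <-> c <= 0.
Proof.
move=> a1 La; split=> [inc|c0].
- rewrite leNgt; apply/negP => c0.
  have [d d0 hd] := legendre_small a1 La c0.
  have d20 : 0 < d / 2 by rewrite divr_gt0.
  have d2d : d / 2 < d by lra.
  have := @g_gt c (d / 2) d d20 d2d _; rewrite ltNge => /(_ _)/negP; apply.
    by move=> z /andP[dz zd]; apply: hd; [exact: lt_trans dz|exact: ltW].
  by apply/ltW/inc; rewrite ?pos_itv.
- move=> x y; rewrite !pos_itv => x0 y0 xy; apply: g_lt => // z /andP[xz _].
  have z0 : 0 < z by exact: lt_trans xz.
  apply: (@le_lt_trans _ _ 0); last exact: legendre_gt0.
  by rewrite mulr_le0_ge0// ltW.
Qed.

Section Root.
Variable x3 : R.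
Hypotheses (x30 : 0 < x3) (px3 : p x3 = 0).
Hypothesis p_neg : forall x, 0 < x -> x < x3 -> p x < 0.
Hypothesis p_pos : forall x, x3 < x -> 0 < p x.

Let Gx3 : G x3 = w x3 * x3.
Proof. by rewrite mulrC; apply/esym/eqP; rewrite -subr_eq0; exact/eqP. Qed.

(** The ratio G / z has derivative p / z^2, so it attains its minimum exactly at
    x3, where it equals w x3 because p x3 = 0. *)
Lemma legendre_gt_tangent z : 0 < z -> z != x3 -> w x3 * z < G z.
Proof.
move=> z0; have -> : w x3 = G x3 / x3 by rewrite Gx3 mulfK// gt_eqF.
rewrite -ltr_pdivlMr// neq_lt => /orP[zx3|x3z].
- apply: (@derive_lt0_gt _ (fun y => G y / y) (fun y => p y / y ^+ 2)
    z x3 zx3) => y /andP[zy yx].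
    by apply: is_derive_legendre_ratio; exact: lt_le_trans zy.
  have y0 : 0 < y by exact: lt_trans zy.
  by rewrite pmulr_llt0 ?invr_gt0 ?exprn_gt0// p_neg.
- apply: (@derive_gt0_lt _ (fun y => G y / y) (fun y => p y / y ^+ 2)
    x3 z x3z) => y /andP[xy yz].
    by apply: is_derive_legendre_ratio; exact: lt_le_trans xy.
  have y0 : 0 < y by exact: lt_trans xy.
  by rewrite divr_gt0 ?exprn_gt0// p_pos.
Qed.

Lemma increasing_root_iff c :
  strictly_increasing `]0, +oo[ (g c) <-> c <= x3 * T (x3 + a).
Proof.
rewrite -/(w x3); split=> [inc|cw].
- have Finc : {in `]0, +oo[ &, {homo F c : x y / x < y}}.
    move=> x y xI yI xy; by rewrite -ltr_expR -!gE -?pos_itv// inc.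
  have dF : {in `]0, +oo[%classic, forall x : R, derivable (F c) x 1}.
    move=> x /set_mem /=; rewrite pos_itv => x0.
    by have [] := is_derive_log_g c x0.
  have x3I : x3 \in `]0, +oo[ by rewrite pos_itv.
  have := incr_derive1_ge0_itvy dF Finc x3I.
  rewrite derive1E (@derive_val _ _ _ _ _ _ _ (is_derive_log_g c x30)).
  by rewrite pmulr_lge0 ?invr_gt0 ?exprn_gt0// subr_ge0 Gx3 ler_pM2r.
- have cG z : 0 < z -> z != x3 -> c * z < G z.
    move=> z0 zx3; apply: le_lt_trans (legendre_gt_tangent z0 zx3).
    by rewrite ler_pM2r.
  move=> x y; rewrite !pos_itv => x0 y0 xy.
  have step u v : 0 < u -> u < v -> v <= x3 \/ x3 <= u -> g c u < g c v.
    move=> u0 uv h; apply: g_lt => // z /andP[uz zv].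
    apply: cG; first exact: lt_trans uz.
    by case: h => h; [rewrite lt_eqF// (lt_le_trans zv)|rewrite gt_eqF// (le_lt_trans h)].
  have [yx3|x3y] := leP y x3; first by apply: step => //; left.
  have [x3x|xx3] := leP x3 x; first by apply: step => //; right.
  apply: (@lt_trans _ _ (g c x3)); apply: step => //; first by left.
  by right.
Qed.

Lemma geo_split_root c :
  geometrically_concave `]0, x3[ (g c) /\ geometrically_convex `]x3, +oo[ (g c).
Proof.
split.
- apply: geometrically_concaveP => [x|x y].
    by rewrite in_itv/= => /andP[].
  rewrite !in_itv/= => /andP[x0 _] /andP[_ yx3] z /andP[xz zy].
  by apply: p_neg; [exact: lt_le_trans xz|exact: le_lt_trans yx3].
- apply: geometrically_convexP => [x|x y].
    by rewrite in_itv/= andbT; exact: lt_trans.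
  rewrite !in_itv/= !andbT => x3x _ z /andP[xz _].
  by apply: p_pos; exact: lt_le_trans xz.
Qed.

End Root.

Lemma geo_discr_eq0 x :
  p x = 0 <-> x ^+ 2 * T (x + a) + L (x + a) = x * psi (x + a).
Proof.
have -> : p x = x ^+ 2 * T (x + a) + L (x + a) - x * psi (x + a).
  by rewrite /geo_discr /legendre /weighted_T; ring.
by split=> /eqP h; apply/eqP; move: h; rewrite subr_eq0.
Qed.

(** In the range where the function is geometrically convex throughout, p has no
    zero.  For a < 1/2, p is close to L a > 0 near 0, which makes the function
    strictly geometrically convex there. *)
Lemma geo_split_only_if c x3 : 0 < x3 -> p x3 = 0 ->
  geometrically_concave `]0, x3[ (g c) -> 1 < a < 2.
Proof.
move=> x30 px3 [_ _ conc]; have ha0 := a0.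
have : ~ geo_convex_range.
  by move=> ha; have := geo_discr_gt0 ha x30; rewrite px3 ltxx.
case/not_geo_convex_range => // a2.
have p0 : 0 < p 0 by rewrite geo_discr0 L_gt0//; left; lra.
have pc : {for 0, continuous p} := is_derive_continuous (is_derive_geo_discr (lexx 0)).
have [e /= e0 he] := (nbhs_ballP _ _).1 (cvgr_gt _ pc _ p0).
pose d := Num.min e x3.
have d0 : 0 < d by rewrite lt_min e0 x30.
have x1 : 0 < d / 3 by rewrite divr_gt0.
have x12 : d / 3 < d / 2 by lra.
have de : d <= e by rewrite ge_min lexx.
have dx3 : d <= x3 by rewrite ge_min lexx orbT.
have pos z : d / 3 <= z <= d / 2 -> 0 < p z.
  move=> /andP[z1 z2]; apply: he; rewrite /ball/= sub0r normrN gtr0_norm; lra.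
have := g_geo_convex_lt c x1 x12 pos; rewrite ltNge conc//= in_itv/=; lra.
Qed.

(** For c < 1 the function is even strictly logarithmically concave near
    infinity. *)
Lemma log_convex_iff c : 2 <= a ->
  strictly_log_convex `]0, +oo[ (g c) <-> 1 <= c.
Proof.
move=> a2; split=> [[_ conv]|c1].
- rewrite leNgt; apply/negP => c1; have ah : 2^-1 <= a by lra.
  have [N N0 hN] := log_discr_eventually_lt0 ah c1.
  have N1 : N < N + 1 by rewrite ltrDl.
  have := @g_log_concave_lt c N (N + 1) N0 N1 _; rewrite ltNge => /(_ _)/negP; apply.
    by move=> z /andP[Nz _]; exact: hN.
  by apply/ltW/conv; rewrite ?pos_itv ?lt_eqF// (lt_trans N0).
- split; first by apply: g_continuous_positive => x; rewrite pos_itv.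
  move=> x y; rewrite !pos_itv => x0 y0.
  have main u v : 0 < u -> u < v -> g c ((u + v) / 2) < Num.sqrt (g c u * g c v).
    move=> u0 uv; apply: g_log_convex_lt => // z /andP[uz _].
    by apply: log_discr_gt0 => //; exact: lt_le_trans uz.
  by rewrite neq_lt => /orP[xy|yx]; [|rewrite addrC (mulrC (g c x))]; exact: main.
Qed.

(** For c > 0 the function is strictly logarithmically convex near 0. *)
Lemma log_concave_iff c : 1 <= a -> L a = 0 ->
  strictly_log_concave `]0, +oo[ (g c) <-> c <= 0.
Proof.
move=> a1 La; split=> [[_ conc]|c0].
- rewrite leNgt; apply/negP => c0.
  have [d d0 hd] := log_discr_small a1 La c0.
  have d20 : 0 < d / 2 by rewrite divr_gt0.
  have d2d : d / 2 < d by lra.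
  have := @g_log_convex_lt c (d / 2) d d20 d2d _; rewrite ltNge => /(_ _)/negP; apply.
    by move=> z /andP[dz zd]; apply: hd => //; exact: lt_le_trans dz.
  by apply/ltW/conc; rewrite ?pos_itv ?lt_eqF.
- split; first by apply: g_continuous_positive => x; rewrite pos_itv.
  move=> x y; rewrite !pos_itv => x0 y0.
  have main u v : 0 < u -> u < v -> Num.sqrt (g c u * g c v) < g c ((u + v) / 2).
    move=> u0 uv; apply: g_log_concave_lt => // z /andP[uz _].
    by apply: log_discr_lt0 => //; exact: lt_le_trans uz.
  by rewrite neq_lt => /orP[xy|yx]; [|rewrite addrC (mulrC (g c x))]; exact: main.
Qed.

End Shape.

(** * The case of the gamma function *)

Lemma g2E (R : realType) (a c x : R) : 0 < a -> 0 < x ->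
  g2 a c x = expR (log_g (@lnGamma R) a c x).
Proof.
move=> a0 x0; have : 0 < Gamma (x + a) by rewrite Gamma_gt0// addr_gt0.
rewrite /g2 /log_g /lnGamma; generalize (Gamma (x + a)) => y y0.
by rewrite expRB /powR !gt_eqF// [_ / x]mulrC.
Qed.

Theorem theorem2 (R : realType) (a : R) (ha : 0 < a) :
  (* (1)(i) *)
  ((2^-1 <= a <= 1 \/ 2 <= a) ->
     forall c : R, strictly_decreasing `]0, +oo[ (g2 a c) <-> 1 <= c) /\
  (* (1)(ii) *)
  ((a = 1 \/ a = 2) ->
     forall c : R, strictly_increasing `]0, +oo[ (g2 a c) <-> c <= 0) /\
  (* (1)(iii), and the "same point" clause of (3) *)
  (1 < a < 2 ->
     exists x3 : R, [/\ 0 < x3, x3_equation a x3,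
       forall c : R, strictly_increasing `]0, +oo[ (g2 a c) <->
                     c <= x3 * trigamma (x3 + a)
     & forall c : R, geometrically_concave `]0, x3[ (g2 a c) /\
                     geometrically_convex `]x3, +oo[ (g2 a c)]) /\
  (* (2) *)
  (2 <= a ->
     forall c : R, strictly_log_convex `]0, +oo[ (g2 a c) <-> 1 <= c) /\
  (a = 2 ->
     forall c : R, strictly_log_concave `]0, +oo[ (g2 a c) <-> c <= 0) /\
  (* (3) *)
  (forall c : R, geometrically_convex `]0, +oo[ (g2 a c) <->
                 (2^-1 <= a <= 1 \/ 2 <= a)) /\
  (forall c : R,
     (exists x3 : R, [/\ 0 < x3, x3_equation a x3,
        geometrically_concave `]0, x3[ (g2 a c)
      & geometrically_convex `]x3, +oo[ (g2 a c)]) <-> 1 < a < 2).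
Proof.
have H := lnGamma_like R.
have gE c x : 0 < x -> g2 a c x = expR (log_g (@lnGamma R) a c x).
  exact: g2E.
have eq3 x : x3_equation a x <->
    geo_discr (@lnGamma R) digamma trigamma a x = 0.
  exact: iff_sym (geo_discr_eq0 _ _ _ _ _).
have L1 : lnGamma (1 : R) = 0 by exact: lgl_1 H.
have L2 : lnGamma (2 : R) = 0 by exact: lgl_2 H.
have split_root : 1 < a < 2 -> exists x3 : R, [/\ 0 < x3, x3_equation a x3,
    forall c : R, strictly_increasing `]0, +oo[ (g2 a c) <->
                  c <= x3 * trigamma (x3 + a)
  & forall c : R, geometrically_concave `]0, x3[ (g2 a c) /\
                  geometrically_convex `]x3, +oo[ (g2 a c)].
  move=> /andP[a1 a2]; have [x3 [x30 px3 neg pos]] := geo_discr_root H ha a1 a2.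
  exists x3; split=> // [|c|c]; first by apply/eq3.
  - exact: (increasing_root_iff H ha gE x30 px3 neg pos).
  - exact: (geo_split_root H ha gE x30 neg pos).
split; [|split; [|split; [|split; [|split; [|split]]]]].
- by move=> har c; exact: (decreasing_iff H ha gE).
- move=> a12 c; apply: (increasing_iff H ha gE).
    by case: a12 => ->; rewrite ?ler1n.
  by case: a12 => ->.
- exact: split_root.
- by move=> a2 c; exact: (log_convex_iff H ha gE).
- move=> a2 c; apply: (log_concave_iff H ha gE); rewrite a2 ?ler1n//.
- by move=> c; exact: (geo_convex_iff H ha gE).
- move=> c; split=> [[x3 [x30 /eq3 px3 conc _]]|/split_root[x3 [x30 e _ h]]].
    exact: (geo_split_only_if H ha gE x30 px3 conc).
  by have [conc conv] := h c; exists x3; split.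
Qed.
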